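(* Consider the $N$ heterogeneous agents $$\dot x_i=A_ix_i+B_iu_i,\qquad y_i=C_ix_i,\qquad i=1,\dots,N,$$ with $x_i\in\mathbb{R}^{n_i}$, $u_i\in\mathbb{R}^{p_i}$, $y_i\in\mathbb{R}^{q}$ and constant real matrices $A_i,B_i,C_i$ of compatible sizes. Suppose that: (1) for each $i$, the local cost function $f_i:\mathbb{R}^q\to\mathbb{R}$ is continuously differentiable and strongly convex with constant $m_i>0$, and $\nabla f_i$ is globally Lipschitz on $\mathbb{R}^q$ with constant $M_i>0$; (2) the communication digraph $\mathcal{G}$, with adjacency matrix $[a_{ij}]\in\mathbb{R}^{N\times N}$ and Laplacian $\mathcal{L}$, is strongly connected (it is not required to be weight-balanced); (3) for each $i$, $(A_i,B_i)$ is stabilizable and $$\operatorname{rank}\begin{bmatrix} C_iB_i & \mathbf{0}_{q\times p_i}\\ -A_iB_i & B_i\end{bmatrix}=n_i+q ;$$ (4) for each $i$, $(A_i,C_i)$ is detectable. For each $i$, let $K_i\in\mathbb{R}^{p_i\times n_i}$ be such that $A_i-B_iK_i$ is Hurwitz, let $H_i\in\mathbb{R}^{n_i\times q}$ be such that $A_i-H_iC_i$ is Hurwitz, and let $(\Upsilon_i,\Phi_i,\Psi_i)$ be a solution of the linear matrix equations $$C_i\Psi_i-I_q=\mathbf{0},\qquad B_i\Phi_i-A_i\Psi_i=\mathbf{0},\qquad B_i\Upsilon_i-\Psi_i=\mathbf{0}.$$ Then there exist positive constants $\gamma_1$ and $\gamma_2$ such that, under the distributed observer-based output feedback controller $$\begin{aligned}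 u_i&=-K_i\hat x_i+\Upsilon_i\omega_i-(\Phi_i-K_i\Psi_i)\rho_i,\\ \dot{\hat x}_i&=A_i\hat x_i+B_iu_i+H_i(y_i-C_i\hat x_i),\\ \dot\rho_i&=\omega_i:=-\frac{\nabla f_i(y_i)}{z_i^i}-\gamma_1\sum_{j=1}^N a_{ij}(y_i-y_j)-\gamma_2v_i,\\ \dot v_i&=\gamma_1\sum_{j=1}^N a_{ij}(y_i-y_j),\\ \dot z_i&=-\sum_{j=1}^N a_{ij}(z_i-z_j), \end{aligned}\qquad i=1,\dots,N,$$ where $\hat x_i\in\mathbb{R}^{n_i}$, $\rho_i,v_i\in\mathbb{R}^q$, $z_i=(z_i^1,\dots,z_i^N)^{\mathrm T}\in\mathbb{R}^N$, with initial values $v_i(0)=\mathbf{0}$, $z_i^i(0)=1$, $z_i^j(0)=0$ for $j\ne i$, and arbitrary $x_i(0)$, $\hat x_i(0)$, $\rho_i(0)$, the stacked output $Y=\operatorname{col}(y_1,\dots,y_N)$ converges exponentially to $\bar Y=\mathbf{1}_N\otimes y^*$, where $y^*$ is the optimal solution of $\min_{y\in\mathbb{R}^q}\sum_{i=1}^N f_i(y)$; here $\bar Y$ is the optimal solution of $$\min_{Y\in\mathbb{R}^{qN}}\ \sum_{i=1}^N f_i(y_i)\quad\text{subject to}\quad(\mathcal{L}\otimes I_q)Y=\mathbf{0}.$$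
   Context: Digraph conventions: $\mathcal{G}=(\mathcal{V},\mathcal{E},\mathcal{A})$ has node set $\mathcal{V}=\{1,\dots,N\}$, edge set $\mathcal{E}\subseteq\mathcal{V}\times\mathcal{V}$ and weighted adjacency matrix $\mathcal{A}=[a_{ij}]$, with $a_{ij}>0$ if $(j,i)\in\mathcal{E}$ (agent $i$ receives information from agent $j$), $a_{ij}=0$ otherwise, and $a_{ii}=0$. The Laplacian $\mathcal{L}=[l_{ij}]$ is $l_{ii}=\sum_{j=1}^N a_{ij}$, $l_{ij}=-a_{ij}$ for $i\ne j$. $\mathcal{G}$ is strongly connected if there is a directed path from every node to every other node; it is weight-balanced iff $\mathbf{1}_N^{\mathrm T}\mathcal{L}=\mathbf{0}_N^{\mathrm T}$. A continuously differentiable $f:\mathbb{R}^q\to\mathbb{R}$ is strongly convex with constant $m>0$ if $(x-y)^{\mathrm T}(\nabla f(x)-\nabla f(y))\ge m\|x-y\|^2$ for all $x,y$. A map $g:\mathbb{R}^q\to\mathbb{R}^q$ is globally Lipschitz with constant $M>0$ if $\|g(x)-g(y)\|\le M\|x-y\|$ for all $x,y$. $\operatorname{col}(\cdot)$ denotes stacking into a column vector; $\mathbf{1}_N$ is the all-ones vector in $\mathbb{R}^N$; $\otimes$ is the Kronecker product; $\|\cdot\|$ is the Euclidean norm. A matrix is Hurwitz if all its eigenvalues have negative real part. Under (3) the linear matrix equations have a solution $(\Upsilon_i,\Phi_i,\Psi_i)$ with $\Upsilon_i,\Phi_i\in\mathbb{R}^{p_i\times q}$, $\Psi_i\in\mathbb{R}^{n_i\times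 q}$; under (2) and the stated initialization $z_i^i(t)>0$ for all $t\ge0$, so the controller is well defined; under (1) $y^*$ exists and is unique. Exponential convergence of $Y$ to $\bar Y$ means that along each closed-loop trajectory there are constants $c\ge 0$, $\alpha>0$ with $\|Y(t)-\bar Y\|\le c\,e^{-\alpha t}$ for all $t\ge0$. *)

(* Defs.v *)
From HB Require Import structures.
From mathcomp Require Import all_boot all_order all_algebra.
From mathcomp Require Import all_classical all_reals all_analysis.
From mathcomp Require Import complex mxtens.

Set Implicit Arguments.
Unset Strict Implicit.
Unset Printing Implicit Defensive.

Import Order.TTheory GRing.Theory Num.Theory.
Import numFieldTopology.Exports numFieldNormedType.Exports.

Local Open Scope classical_set_scope.
Local Open Scope ring_scope.

Definition dotp (R : realType) (k : nat) (u v : 'cV[R]_k) : R :=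
  (u^T *m v) 0 0.

(* The canonical norm of ['cV[R]_k] in the library is the sup norm. *)
Definition enorm (R : realType) (k : nat) (v : 'cV[R]_k) : R :=
  Num.sqrt (\sum_(i < k) v i 0 ^+ 2).

Definition gradient (R : realType) (q : nat) (f : 'cV[R]_q -> R)
    (x : 'cV[R]_q) : 'cV[R]_q :=
  \col_(k < q) 'D_(delta_mx k 0) f x.

Definition C1 (R : realType) (q : nat) (f : 'cV[R]_q -> R) : Prop :=
  (forall x, differentiable f x) /\ continuous (gradient f).

Definition strongly_convex (R : realType) (q : nat) (f : 'cV[R]_q -> R)
    (m : R) : Prop :=
  forall x y : 'cV[R]_q,
    m * enorm (x - y) ^+ 2 <= dotp (x - y) (gradient f x - gradient f y).

Definition globally_lipschitz (R : realType) (q : nat)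
    (g : 'cV[R]_q -> 'cV[R]_q) (M : R) : Prop :=
  forall x y : 'cV[R]_q, enorm (g x - g y) <= M * enorm (x - y).

(* Eigenvalues are taken in the complex numbers [R[i]]. *)
Definition hurwitz (R : realType) (n : nat) (A : 'M[R]_n) : Prop :=
  forall lam : R[i],
    eigenvalue (map_mx (real_complex R) A) lam -> complex.Re lam < 0.

Definition stabilizable (R : realType) (n p : nat) (A : 'M[R]_n)
    (B : 'M[R]_(n, p)) : Prop :=
  exists K : 'M[R]_(p, n), hurwitz (A - B *m K).

Definition detectable (R : realType) (n q : nat) (A : 'M[R]_n)
    (C : 'M[R]_(q, n)) : Prop :=
  exists H : 'M[R]_(n, q), hurwitz (A - H *m C).

(* [edge j i] is the edge (j, i): agent i receives information from agent j. *)
Definition weighted_adjacency (R : realType) (N : nat) (edge : rel 'I_N)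
    (a : 'M[R]_N) : Prop :=
  [/\ forall i j, edge j i -> 0 < a i j,
      forall i j, ~~ edge j i -> a i j = 0
    & forall i, a i i = 0].

Definition strongly_connected (N : nat) (edge : rel 'I_N) : Prop :=
  forall i j : 'I_N, connect edge i j.

Definition laplacian (R : realType) (N : nat) (a : 'M[R]_N) : 'M[R]_N :=
  \matrix_(i, j) if i == j then \sum_(k < N) a i k else - a i j.

(* Stacked vectors of R^(qN) use the index order of the Kronecker product
   [*t]: entry k of block i sits at position i * q + k. *)
Definition stack (R : realType) (N q : nat) (y : 'I_N -> 'cV[R]_q) :
    'cV[R]_(N * q) :=
  \col_l y (mxtens_unindex l).1 (mxtens_unindex l).2 0.

Definition block (R : realType) (N q : nat) (Y : 'cV[R]_(N * q)) (i : 'I_N) :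
    'cV[R]_q :=
  \col_k Y (mxtens_index (i, k)) 0.

Definition is_minimizer (R : realType) (T : Type) (D : set T) (F : T -> R)
    (x : T) : Prop :=
  D x /\ forall y, D y -> F x <= F y.

Definition is_the_minimizer (R : realType) (T : Type) (D : set T) (F : T -> R)
    (x : T) : Prop :=
  is_minimizer D F x /\ forall y, is_minimizer D F y -> y = x.

(* [x] solves [x' = w] on the half-line [0, +oo[; the continuity requirement
   links the derivative on t > 0 to the initial value at t = 0. *)
Definition solves (R : realType) (k : nat) (x w : R -> 'cV[R]_k) : Prop :=
  {within `[0, +oo[, continuous x} /\
  forall t : R, 0 < t -> is_derive t 1 x (w t).

(* Main.v *)
Require Import Defs.
From HB Require Import structures.
From mathcomp Require Import all_boot all_order all_algebra.
From mathcomp Require Import all_classical all_reals all_analysis.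
From mathcomp Require Import complex mxtens.
From mathcomp Require Import ring lra.
Import Order.TTheory GRing.Theory Num.Theory.
Import numFieldTopology.Exports numFieldNormedType.Exports.
Local Open Scope classical_set_scope.
Local Open Scope ring_scope.

Set Implicit Arguments.
Unset Strict Implicit.
Unset Printing Implicit Defensive.

(** Why the closed loop converges.

    Agent by agent, the estimation error [e = x - xhat] satisfies
    [e' = (A - H C) e].  The regulator equations give [B Ups = Psi],
    [B Phi = A Psi] and [C Psi = 1]; with them, [xi = x - Psi rho] satisfies
    [xi' = (A - B K) xi + B K e], and [C x = rho + C xi].  Both matrices are
    Hurwitz, so the output obeys the dynamics designed for [rho],
    [y' = omega + eta], up to an exponentially decaying [eta]
    ([tracking_output], from [hurwitz_small]).

    The network is handled with the left null vector [r] of the Laplacian [L],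
    which strong connectivity makes positive ([laplacian_left_null]).  In the
    inner product [wdot r], which gives row [i] the weight [r i], [L] behaves
    as the Laplacian of a weight-balanced graph: [wdot r X (L X)] is a sum of
    squares of differences across the edges, and it dominates the [r]-variance
    of the columns of [X] ([weighted_poincare_mx]).  One consequence is that
    the [i]-th component of [z i] tends to [r i] exponentially fast
    ([left_null_estimator_cvg]), so that dividing the gradient by it amounts,
    up to a decaying error, to dividing by [r i].  This corrects the imbalance
    of the graph: the equilibrium is then the point where the plain sum of the
    gradients vanishes, that is, the minimizer.

    Let [Y] and [W] be the deviations of [y] and [v] from that equilibrium.
    The column means of [W] with weights [r] stay zero because [v] starts at
    zero and [r L = 0].  For [gamma2 = 1], the function
    [wdot r (Y + W) (Y + W) + k * wdot r Y Y] decreases exponentially once [k]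
    is large compared with the Lipschitz constants and [gamma1] is large
    compared with [k]: differentiating the first term produces [- wdot r W W],
    strong convexity controls [wdot r Y Y], and the only dangerous cross term,
    [wdot r Y W], involves the deviation of [Y] from its mean alone, which the
    term [gamma1 * wdot r Y (L Y)] absorbs
    ([consensus_optimization_lyapunov]).  The two decaying perturbations are
    absorbed by the same comparison argument ([exp_small_lyapunov]), after a
    time that depends on the trajectory. *)

(** * Entrywise calculus of differential equations on the half-line *)

(** The vector-valued [solves] splits into entries, and all the calculus below
    (products, Lyapunov functions) is done on real-valued functions. *)
Definition scalar_solves (R : realType) (x w : R -> R) : Prop :=
  {within `[0, +oo[, continuous x} /\
  forall t : R, 0 < t -> is_derive t 1 x (w t).

Definition mx_solves (R : realType) (m n : nat) (X W : R -> 'M[R]_(m, n)) :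
    Prop :=
  forall i j, scalar_solves (fun t => X t i j) (fun t => W t i j).

Lemma scalar_solves_eq (R : realType) (x w w' : R -> R) :
  scalar_solves x w -> (forall t : R, 0 < t -> w t = w' t) ->
  scalar_solves x w'.
Proof. by move=> [cx dx] ww'; split => // t t0; rewrite -ww'//; exact: dx. Qed.

Lemma scalar_solves_ext (R : realType) (x x' w w' : R -> R) :
  scalar_solves x' w' -> x =1 x' -> w =1 w' -> scalar_solves x w.
Proof. by move=> + /funext -> /funext ->. Qed.

Lemma scalar_solves_cst (R : realType) (c : R) :
  scalar_solves (fun=> c) (fun=> 0).
Proof.
split; first by move=> ?; exact: cvg_cst.
by move=> t _; exact: is_derive_cst.
Qed.

Lemma scalar_solvesD (R : realType) (x y w z : R -> R) :
  scalar_solves x w -> scalar_solves y z ->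
  scalar_solves (fun t => x t + y t) (fun t => w t + z t).
Proof.
move=> [cx dx] [cy dy]; split.
  by move=> t; apply: cvgD; [exact: cx|exact: cy].
by move=> t t0; apply: is_deriveD; [exact: dx|exact: dy].
Qed.

Lemma scalar_solvesM (R : realType) (x y w z : R -> R) :
  scalar_solves x w -> scalar_solves y z ->
  scalar_solves (fun t => x t * y t) (fun t => w t * y t + x t * z t).
Proof.
move=> [cx dx] [cy dy]; split.
  by move=> t; apply: cvgM; [exact: cx|exact: cy].
move=> t t0; have := dx t t0; have := dy t t0 => dyt dxt.
by apply: is_derive_eq; rewrite addrC /GRing.scale/= (mulrC (w t)).
Qed.

Lemma scalar_solvesZ (R : realType) (c : R) (x w : R -> R) :
  scalar_solves x w -> scalar_solves (fun t => c * x t) (fun t => c * w t).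
Proof.
move=> xw; have := scalar_solvesM (scalar_solves_cst c) xw.
by move=> /scalar_solves_eq; apply => t _; rewrite mul0r add0r.
Qed.

Lemma scalar_solves_sum (R : realType) (I : Type) (s : seq I)
    (x w : I -> R -> R) :
  (forall i, scalar_solves (x i) (w i)) ->
  scalar_solves (fun t => \sum_(i <- s) x i t) (fun t => \sum_(i <- s) w i t).
Proof.
move=> xw; elim: s => [|i s IHs].
  by apply: scalar_solves_ext (scalar_solves_cst 0) _ _ => t; rewrite big_nil.
apply: scalar_solves_ext (scalar_solvesD (xw i) IHs) _ _ => t;
  by rewrite big_cons.
Qed.

Lemma solves_coord (R : realType) (k : nat) (x w : R -> 'cV[R]_k) :
  solves x w -> mx_solves x w.
Proof.
move=> [cx dx] i j; split.
  by move=> t; apply: (cvg_comp _ (fun M : 'cV[R]_k => M i j) (cx t));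
    exact: coord_continuous.
move=> t t0; have [dX <-] := dx t t0.
by rewrite derive_mx// mxE; apply: DeriveDef => //; move/derivable_mxP: dX.
Qed.

Lemma mx_solves_eq (R : realType) (m n : nat) (X W W' : R -> 'M[R]_(m, n)) :
  mx_solves X W -> (forall t : R, 0 < t -> W t = W' t) ->
  mx_solves X W'.
Proof.
move=> XW WW' i j; apply: scalar_solves_eq (XW i j) _ => t t0.
by rewrite WW'.
Qed.

Lemma mx_solves_cst (R : realType) (m n : nat) (M : 'M[R]_(m, n)) :
  mx_solves (fun=> M) (fun=> 0).
Proof.
move=> i j; apply: scalar_solves_eq (scalar_solves_cst _) _ => t _.
by rewrite mxE.
Qed.

Lemma mx_solvesD (R : realType) (m n : nat) (X Y W Z : R -> 'M[R]_(m, n)) :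
  mx_solves X W -> mx_solves Y Z ->
  mx_solves (fun t => X t + Y t) (fun t => W t + Z t).
Proof.
move=> XW YZ i j.
by apply: scalar_solves_ext (scalar_solvesD (XW i j) (YZ i j)) _ _ => t;
  rewrite mxE.
Qed.

Lemma mx_solvesM (R : realType) (l m n : nat) (M : 'M[R]_(l, m))
    (X W : R -> 'M[R]_(m, n)) :
  mx_solves X W ->
  mx_solves (fun t => M *m X t) (fun t => M *m W t).
Proof.
move=> XW i j.
have XWk k := scalar_solvesZ (M i k) (XW k j).
by apply: scalar_solves_ext (scalar_solves_sum _ XWk) _ _ => t; rewrite mxE.
Qed.

Lemma mx_solvesB (R : realType) (m n : nat) (X Y W Z : R -> 'M[R]_(m, n)) :
  mx_solves X W -> mx_solves Y Z ->
  mx_solves (fun t => X t - Y t) (fun t => W t - Z t).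
Proof.
move=> XW YZ i j.
apply: scalar_solves_ext
  (scalar_solvesD (XW i j) (scalar_solvesZ (- 1) (YZ i j))) _ _ => t;
  by rewrite !mxE mulN1r.
Qed.

Lemma scalar_solves_const (R : realType) (x : R -> R) :
  scalar_solves x (fun=> 0) -> forall t : R, 0 <= t -> x t = x 0.
Proof.
move=> [cx dx] t t0.
have d0 s : s \in `]0, t[%R -> is_derive s 1 x 0.
  by move=> st; apply: dx; rewrite (itvP st).
have c0 : {within `[0, t], continuous x}.
  apply: continuous_subspaceW cx => s /=.
  by rewrite !in_itv/= => /andP[->].
have [s _] := @MVT_segment R x (fun=> 0) 0 t t0 d0 c0.
by rewrite mul0r => /eqP; rewrite subr_eq0 => /eqP.
Qed.

(** * Exponential decay *)

(** Only the behaviour for large times is constrained.  A quantity such as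
    [1 / z] is controlled only after some time, and continuity takes care of
    the remaining compact interval at the very end ([exp_small_global]). *)
Definition exp_small (R : realType) (g : R -> R) : Prop :=
  exists c alpha T : R, [/\ 0 < alpha, 0 <= T &
    forall t : R, T <= t -> `|g t| <= c * expR (- alpha * t)].

Lemma exp_small_le (R : realType) (g h : R -> R) (T0 : R) :
  (forall t : R, 0 <= t -> T0 <= t -> `|g t| <= `|h t|) ->
  exp_small h -> exp_small g.
Proof.
move=> gh [c [al [T [al0 T0' hT]]]].
exists c, al, (Num.max T T0); split => //; first by rewrite le_max T0'.
move=> t; rewrite ge_max => /andP[Tt T0t].
by apply: le_trans (hT _ Tt); apply: gh => //; exact: le_trans Tt.
Qed.

Lemma exp_small_ext (R : realType) (g h : R -> R) :
  exp_small h -> g =1 h -> exp_small g.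
Proof. by move=> + /funext ->. Qed.

Lemma exp_small0 (R : realType) : exp_small (fun=> 0 : R).
Proof. by exists 0, 1, 0; split => // t _; rewrite normr0 mul0r. Qed.

Lemma exp_smallD (R : realType) (g h : R -> R) :
  exp_small g -> exp_small h -> exp_small (fun t => g t + h t).
Proof.
move=> [c [al [T [al0 T0 gT]]]] [d [be [S [be0 S0 hS]]]].
exists (`|c| + `|d|), (Num.min al be), (Num.max T S).
split; [by rewrite lt_min al0|by rewrite le_max T0|move=> t].
rewrite ge_max => /andP[Tt St].
have t0 : 0 <= t by exact: le_trans Tt.
have le_exp (e u v : R) : u <= v -> e * expR (- v * t) <= `|e| * expR (- u * t).
  move=> uv; apply: (@le_trans _ _ (`|e| * expR (- v * t))).
    by rewrite ler_wpM2r ?expR_ge0 ?ler_norm.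
  by rewrite ler_wpM2l// ler_expR ler_wpM2r// lerN2.
rewrite (le_trans (ler_normD _ _))// mulrDl lerD//.
  by apply: le_trans (gT _ Tt) _; apply: le_exp; rewrite ge_min lexx.
by apply: le_trans (hS _ St) _; apply: le_exp; rewrite ge_min lexx orbT.
Qed.

Lemma exp_small_eventually (R : realType) (g : R -> R) (e : R) :
  exp_small g -> 0 < e ->
  exists2 T : R, 0 <= T & forall t : R, T <= t -> `|g t| <= e.
Proof.
move=> [c [al [T [al0 T0 gT]]]] e0.
exists (Num.max T ((`|c| / e) / al)); first by rewrite le_max T0.
move=> t; rewrite ge_max => /andP[Tt]; rewrite ler_pdivrMr// => ct.
apply: le_trans (gT _ Tt) _.
apply: (@le_trans _ _ (`|c| * expR (- al * t))).
  by rewrite ler_wpM2r ?expR_ge0 ?ler_norm.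
have /= := expR_ge1Dx (al * t) => He.
rewrite mulNr expRN ler_pdivrMr ?expR_gt0//.
apply: (@le_trans _ _ (e * (`|c| / e))); first by rewrite mulrC divfK// gt_eqF.
by rewrite ler_wpM2l ?(ltW e0)//; lra.
Qed.

Lemma exp_smallZ (R : realType) (a : R) (g : R -> R) :
  exp_small g -> exp_small (fun t => a * g t).
Proof.
move=> [c [al [T [al0 T0 gT]]]]; exists (`|a| * c), al, T; split => // t Tt.
by rewrite normrM -mulrA ler_wpM2l// gT.
Qed.

Lemma exp_smallM (R : realType) (g h : R -> R) :
  exp_small g -> exp_small h -> exp_small (fun t => g t * h t).
Proof.
move=> sg sh; have [T T0 gT] := exp_small_eventually sg ltr01.
apply: (@exp_small_le R _ h T) sh => t _ Tt.
by rewrite normrM -[leRHS]mul1r ler_wpM2r// gT.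
Qed.

Lemma exp_small_sum (R : realType) (I : Type) (s : seq I) (g : I -> R -> R) :
  (forall i, exp_small (g i)) ->
  exp_small (fun t => \sum_(i <- s) g i t).
Proof.
move=> sg; elim: s => [|i s IHs].
  by apply: exp_small_ext (exp_small0 _) _ => t; rewrite /= big_nil.
by apply: exp_small_ext (exp_smallD (sg i) IHs) _ => t; rewrite /= big_cons.
Qed.

Lemma exp_small_sqr (R : realType) (g : R -> R) :
  exp_small (fun t => g t ^+ 2) -> exp_small g.
Proof.
move=> [c [al [T [al0 T0 gT]]]]; exists (Num.sqrt c), (al / 2), T.
split => // [|t Tt]; first by rewrite divr_gt0.
have := gT t Tt; rewrite ger0_norm ?sqr_ge0// => gt.
have c0 : 0 <= c.
  have := le_trans (sqr_ge0 (g t)) gt.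
  by rewrite pmulr_lge0// expR_gt0.
rewrite -(@ler_pXn2r _ 2)// ?nnegrE ?mulr_ge0 ?sqrtr_ge0 ?expR_ge0//.
rewrite real_normK ?num_real// exprMn sqr_sqrtr// -expRM_natl.
by rewrite (_ : _ * (_ * t) = - al * t)//; field.
Qed.

(** The forcing [h] is bounded by [b * exp (- be * t)]; adding
    [k * exp (- be * t)] to [V], for a suitable [k], makes the forcing
    disappear: the sum decreases at any rate that is at most [a] and
    [be / 2]. *)
Lemma exp_small_lyapunov (R : realType) (V W : R -> R) (a : R) (h : R -> R)
    (T0 : R) :
  scalar_solves V W -> (forall t, 0 <= V t) ->  0 < a -> exp_small h ->
  (forall t : R, 0 < t -> T0 <= t -> W t <= - a * V t + h t) -> exp_small V.
Proof.
move=> [cV dV] V0 a0 [b0 [be [T1 [be0 T1p hT]]]] WV.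
pose T := Num.max 1 (Num.max T0 T1).
have Tp : 0 < T by rewrite lt_max ltr01.
pose al := Num.min a (be / 2).
have al0 : 0 < al by rewrite lt_min a0 divr_gt0.
have ala : al <= a by rewrite ge_min lexx.
have albe : al <= be / 2 by rewrite ge_min lexx orbT.
pose b : R := `|b0|.
(* The derivative of [k * exp (- be * t)] is then [- 2 * b * exp (- be * t)]:
   half of it cancels [h], the other half provides the decay of the added
   term. *)
pose k : R := 2 * b / be.
have k0 : 0 <= k by rewrite divr_ge0 ?mulr_ge0 ?normr_ge0 ?(ltW be0).
pose U (t : R) : R := expR (al * t) * (V t + k * expR (- be * t)).
have dU (t : R) : 0 < t -> is_derive t 1 U
    (expR (al * t) * (al * (V t + k * expR (- be * t))
      + (W t - k * be * expR (- be * t)))).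
  move=> t0; have dVt := dV t t0; rewrite /U.
  have e1 (c : R) : is_derive t 1 (fun s : R => expR (c * s))
      (c * expR (c * t)).
    have e0 : is_derive t 1 (fun s : R => c * s) c.
      by apply: is_derive_eq; rewrite /GRing.scale/= mulr1.
    have := @is_derive1_comp R expR (fun s : R => c * s) t _ _
      (is_derive_expR _) e0.
    by rewrite mulrC.
  have e2 := e1 al; have e3 := e1 (- be).
  have e4 : is_derive t 1 (fun s => V s + k * expR (- be * s))
     (W t + k * (- be * expR (- be * t))).
    exact: (@is_deriveD _ _ _ V _ t 1 _ _ dVt
      (@is_deriveZ _ _ _ (fun s : R => expR (- be * s)) k t 1 _ e3)).
  have e5 := @is_deriveM _ _ (fun s : R => expR (al * s))
    (fun s : R => V s + k * expR (- be * s)) t 1 _ _ e2 e4.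
  apply: (@is_derive_eq _ _ _ _ _ _ _ _ e5).
  by rewrite /GRing.scale/=; ring.
have U_le (t : R) : T <= t -> U t <= U T.
  move=> Tt; have tp s : s \in `]T, t[%R -> 0 < s.
    by rewrite in_itv/= => /andP[Ts _]; exact: lt_trans Ts.
  apply: (@ler0_derive1_le_cc R U T t) => //.
  - by move=> s /tp s0; have [] := dU s s0.
  - move=> s sT; have s0 := tp s sT; rewrite derive1E.
    have -> := @derive_val _ _ _ _ _ _ _ (dU s s0).
    rewrite pmulr_rle0 ?expR_gt0//.
    have {sT} Ts : T <= s by rewrite (itvP sT).
    move: (Ts); rewrite !ge_max => /and3P[_ T0s T1s].
    have := WV s s0 T0s; have := le_trans (ler_norm _) (hT s T1s).
    set E := expR (- be * s) => hs Ws.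
    have E0 : 0 < E by exact: expR_gt0.
    have hs' : h s <= b * E.
      by apply: le_trans hs _; rewrite ler_wpM2r ?(ltW E0)// ler_norm.
    have alV : al * V s <= a * V s by rewrite ler_wpM2r.
    have alk : al * (k * E) <= be / 2 * (k * E).
      by rewrite ler_wpM2r// mulr_ge0// ltW.
    have kE : be / 2 * (k * E) = b * E by rewrite /k; field; rewrite gt_eqF.
    have kE2 : k * be * E = 2 * (b * E) by rewrite /k; field; rewrite gt_eqF.
    rewrite kE2 mulrDr; rewrite kE in alk; lra.
  - apply: continuous_in_subspaceT => s.
    rewrite inE/= in_itv/= => /andP[Ts _].
    have s0 : 0 < s by exact: lt_le_trans Ts.
    apply: differentiable_continuous; apply/derivable1_diffP.
    by have [] := dU s s0.
  - by rewrite in_itv/= lexx Tt.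
  - by rewrite in_itv/= lexx Tt.
exists (U T), al, T; split => //; first exact: ltW.
move=> t Tt; rewrite ger0_norm//.
have : expR (al * t) * V t <= U T.
  apply: le_trans (U_le t Tt); rewrite /U ler_wpM2l ?expR_ge0//.
  by rewrite lerDl mulr_ge0 ?expR_ge0.
by rewrite mulNr expRN ler_pdivlMr ?expR_gt0// mulrC.
Qed.

Lemma exp_small_global (R : realType) (g : R -> R) :
  {within `[0, +oo[, continuous g} -> exp_small g ->
  exists c alpha : R, [/\ 0 <= c, 0 < alpha &
    forall t : R, 0 <= t -> `|g t| <= c * expR (- alpha * t)].
Proof.
move=> cg [c [al [T [al0 T0 gT]]]].
have cgT : {within `[0, T], continuous (fun s => `|g s|)}.
  have cT : {within `[0, T], continuous g}.
    apply: continuous_subspaceW cg => s /=.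
    by rewrite !in_itv/= => /andP[->].
  by move=> s; apply: cvg_norm; exact: cT.
have [s0 _ gs] := EVT_max T0 cgT.
set d := `|g s0| in gs; have d0 : 0 <= d by exact: normr_ge0.
exists (`|c| + d * expR (al * T)), al; split => //.
  by rewrite addr_ge0// mulr_ge0 ?d0 ?expR_ge0.
move=> t t0; rewrite mulrDl -mulrA -expRD.
case: (leP T t) => [Tt|tT].
  apply: le_trans (gT t Tt) _; apply: (@le_trans _ _ (`|c| * expR (- al * t))).
    by rewrite ler_wpM2r ?expR_ge0 ?ler_norm.
  by rewrite lerDl mulr_ge0 ?d0 ?expR_ge0.
have gt : `|g t| <= d by apply: gs; rewrite in_itv/= t0 ltW.
apply: le_trans gt _; apply: (@le_trans _ _ (d * expR (al * T + - al * t))).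
  rewrite ler_peMr// -expR0 ler_expR mulNr -mulrBr.
  by rewrite mulr_ge0 ?ltW// subr_gt0.
by rewrite lerDr mulr_ge0 ?d0 ?expR_ge0.
Qed.

(** * Hurwitz linear systems *)

Definition complex_solves (R : realType) (x w : R -> R[i]) : Prop :=
  scalar_solves (fun t => complex.Re (x t)) (fun t => complex.Re (w t)) /\
  scalar_solves (fun t => complex.Im (x t)) (fun t => complex.Im (w t)).

Definition complex_small (R : realType) (g : R -> R[i]) : Prop :=
  exp_small (fun t => complex.Re (g t)) /\
  exp_small (fun t => complex.Im (g t)).

Lemma ReD (R : realType) (x y : R[i]) :
  complex.Re (x + y) = complex.Re x + complex.Re y.
Proof. by case: x y => ? ? [? ?]. Qed.

Lemma ImD (R : realType) (x y : R[i]) :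
  complex.Im (x + y) = complex.Im x + complex.Im y.
Proof. by case: x y => ? ? [? ?]. Qed.

Lemma ReM (R : realType) (x y : R[i]) : complex.Re (x * y) =
  complex.Re x * complex.Re y + - complex.Im x * complex.Im y.
Proof. by case: x y => ? ? [? ?] /=; rewrite mulNr. Qed.

Lemma ImM (R : realType) (x y : R[i]) : complex.Im (x * y) =
  complex.Re x * complex.Im y + complex.Im x * complex.Re y.
Proof. by case: x y => ? ? [? ?]. Qed.

Lemma complex_solves_eq (R : realType) (x w w' : R -> R[i]) :
  complex_solves x w -> w =1 w' -> complex_solves x w'.
Proof. by move=> + /funext <-. Qed.

Lemma complex_solvesZ (R : realType) (c : R[i]) (x w : R -> R[i]) :
  complex_solves x w -> complex_solves (fun t => c * x t) (fun t => c * w t).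
Proof.
move=> [xr xi]; split.
  apply: scalar_solves_ext
    (scalar_solvesD (scalar_solvesZ (complex.Re c) xr)
      (scalar_solvesZ (- complex.Im c) xi)) _ _ => t; exact: ReM.
apply: scalar_solves_ext
  (scalar_solvesD (scalar_solvesZ (complex.Re c) xi)
    (scalar_solvesZ (complex.Im c) xr)) _ _ => t; exact: ImM.
Qed.

Lemma complex_solves_sum (R : realType) (I : Type) (s : seq I)
    (x w : I -> R -> R[i]) :
  (forall i, complex_solves (x i) (w i)) ->
  complex_solves (fun t => \sum_(i <- s) x i t) (fun t => \sum_(i <- s) w i t).
Proof.
move=> xw; split.
  apply: scalar_solves_ext (scalar_solves_sum s (fun i => (xw i).1)) _ _ => t;
    exact: (big_morph _ (@ReD R) erefl).
apply: scalar_solves_ext (scalar_solves_sum s (fun i => (xw i).2)) _ _ => t;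
  exact: (big_morph _ (@ImD R) erefl).
Qed.

Lemma complex_smallD (R : realType) (g h : R -> R[i]) :
  complex_small g -> complex_small h -> complex_small (fun t => g t + h t).
Proof.
move=> [gr gi] [hr hi]; split.
  by apply: exp_small_ext (exp_smallD gr hr) _ => t; exact: ReD.
by apply: exp_small_ext (exp_smallD gi hi) _ => t; exact: ImD.
Qed.

Lemma complex_smallZ (R : realType) (c : R[i]) (g : R -> R[i]) :
  complex_small g -> complex_small (fun t => c * g t).
Proof.
move=> [gr gi]; split.
  apply: exp_small_ext (exp_smallD (exp_smallZ (complex.Re c) gr)
    (exp_smallZ (- complex.Im c) gi)) _ => t; exact: ReM.
apply: exp_small_ext (exp_smallD (exp_smallZ (complex.Re c) gi)
  (exp_smallZ (complex.Im c) gr)) _ => t; exact: ImM.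
Qed.

Lemma complex_small_sum (R : realType) (I : Type) (s : seq I)
    (g : I -> R -> R[i]) :
  (forall i, complex_small (g i)) ->
  complex_small (fun t => \sum_(i <- s) g i t).
Proof.
move=> sg; split.
  apply: exp_small_ext (exp_small_sum s (fun i => (sg i).1)) _ => t;
    exact: (big_morph _ (@ReD R) erefl).
apply: exp_small_ext (exp_small_sum s (fun i => (sg i).2)) _ => t;
  exact: (big_morph _ (@ImD R) erefl).
Qed.

(** The squared modulus of [x] is a Lyapunov function, its derivative being
    [2 * Re lam * |x|^2] plus a term in [h] bounded by Young's inequality. *)
Lemma complex_mode_small (R : realType) (lam : R[i]) (x h : R -> R[i]) :
  complex.Re lam < 0 -> complex_solves x (fun t => lam * x t + h t) ->
  complex_small h -> complex_small x.
Proof.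
move=> lam0 [xr xi] [hr hi].
pose mu : R := - complex.Re lam.
have mu0 : 0 < mu by rewrite oppr_gt0.
pose V t := complex.Re (x t) ^+ 2 + complex.Im (x t) ^+ 2.
pose g t := mu^-1 * (complex.Re (h t) * complex.Re (h t)
  + complex.Im (h t) * complex.Im (h t)).
have gs : exp_small g.
  by apply: exp_smallZ; apply: exp_smallD; exact: exp_smallM.
have dV := scalar_solvesD (scalar_solvesM xr xr) (scalar_solvesM xi xi).
have sV : exp_small V.
  apply: (exp_small_lyapunov (T0 := 0) dV _ mu0 gs) => [t|t _ _].
    by rewrite addr_ge0// ?sqr_ge0.
  rewrite !(ReD, ImD, ReM, ImM) /g.
  set a := complex.Re (x t); set b := complex.Im (x t).
  set c := complex.Re (h t); set d := complex.Im (h t).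
  have -> : complex.Re lam = - mu by rewrite /mu opprK.
  rewrite -subr_ge0; set rhs := (X in 0 <= X).
  have -> : rhs = mu * ((a - mu^-1 * c) ^+ 2 + (b - mu^-1 * d) ^+ 2).
    by rewrite /rhs; field; rewrite gt_eqF.
  by rewrite mulr_ge0 ?(ltW mu0)// addr_ge0 ?sqr_ge0.
split; apply: exp_small_sqr; apply: (exp_small_le (T0 := 0) _ sV) => t _ _.
  rewrite !ger0_norm ?addr_ge0 ?sqr_ge0//; by rewrite lerDl sqr_ge0.
rewrite !ger0_norm ?addr_ge0 ?sqr_ge0//; by rewrite lerDr sqr_ge0.
Qed.

(** Induction on the roots: [(M - lam) x] solves the same equation and is
    annihilated, up to a decaying term, by one factor less, so it decays; then
    each entry of [x] solves the scalar equation [x' = lam x + decaying].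
    This replaces a triangularization of [M]. *)
Lemma annihilated_small (R : realType) (n : nat) (M : 'M[R[i]]_n)
    (s : seq R[i]) (x h : R -> 'cV[R[i]]_n) :
  (forall lam, lam \in s -> complex.Re lam < 0) ->
  (forall i, complex_solves (fun t => x t i 0)
                            (fun t => (M *m x t + h t) i 0)) ->
  (forall i, complex_small (fun t => h t i 0)) ->
  (forall i, complex_small (fun t =>
     (foldr (fun lam P => P *m (M - lam%:M)) 1%:M s *m x t) i 0)) ->
  forall i, complex_small (fun t => x t i 0).
Proof.
elim: s x h => [|lam s IHs] x h s0 dx sh sx.
  by move=> i; have := sx i; under eq_fun do rewrite mul1mx.
have cmul (P : 'M[R[i]]_n) (y w : R -> 'cV[R[i]]_n) :
    (forall i, complex_solves (fun t => y t i 0) (fun t => w t i 0)) ->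
    forall i,
    complex_solves (fun t => (P *m y t) i 0) (fun t => (P *m w t) i 0).
  move=> yw i; have := complex_solves_sum (index_enum _)
    (fun k => complex_solvesZ (P i k) (yw k)).
  by congr complex_solves; apply/funext => t; rewrite mxE.
have smul (P : 'M[R[i]]_n) (y : R -> 'cV[R[i]]_n) :
    (forall i, complex_small (fun t => y t i 0)) ->
    forall i, complex_small (fun t => (P *m y t) i 0).
  move=> sy i; have := complex_small_sum (index_enum _)
    (fun k => complex_smallZ (P i k) (sy k)).
  by congr complex_small; apply/funext => t; rewrite mxE.
pose D := M - lam%:M.
have sDx : forall i, complex_small (fun t => (D *m x t) i 0).
  apply: (IHs (fun t => D *m x t) (fun t => D *m h t)).
  - by move=> mu mus; apply: s0; rewrite inE mus orbT.
  - move=> i; apply: complex_solves_eq (cmul D _ _ dx i) _ => t.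
    congr ((_ : 'cV_n) i 0); rewrite mulmxDr !mulmxA; congr (_ *m _ + _).
    by rewrite /D mulmxBl mulmxBr scalar_mxC.
  - exact: smul.
  - by move=> i; have := sx i; congr complex_small; apply/funext => t;
      rewrite /= mulmxA.
move=> i; apply: (complex_mode_small (lam := lam)
  (h := fun t => (D *m x t) i 0 + h t i 0)).
- by apply: s0; rewrite inE eqxx.
- apply: complex_solves_eq (dx i) _ => t.
  by rewrite /D mulmxBl mul_scalar_mx !mxE addrA (addrC (lam * _)) subrK.
- by apply: complex_smallD.
Qed.

(** The characteristic polynomial splits over the complex numbers and, by
    Cayley-Hamilton, the product of the factors [A - lam] vanishes. *)
Lemma hurwitz_small (R : realType) (n : nat) (A : 'M[R]_n)
    (x h : R -> 'cV[R]_n) :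
  hurwitz A -> mx_solves x (fun t => A *m x t + h t) ->
  (forall i, exp_small (fun t => h t i 0)) ->
  forall i, exp_small (fun t => x t i 0).
Proof.
case: n A x h => [|n] A x h hA dx sh; first by case.
pose toC := map_mx (real_complex R).
have [s charE] := closed_field_poly_normal (char_poly (toC _ _ A)).
rewrite (monicP (char_poly_monic _)) scale1r in charE.
have s0 lam : lam \in s -> complex.Re lam < 0.
  by move=> ls; apply: hA; rewrite eigenvalue_root_char charE root_prod_XsubC.
have prod0 : foldr (fun lam P => P *m (toC _ _ A - lam%:M)) 1%:M s = 0.
  have := Cayley_Hamilton (toC _ _ A).
  rewrite charE => <-; elim: s {charE s0} => [|lam s IHs].
    by rewrite big_nil [RHS]rmorph1.
  rewrite big_cons mulrC rmorphM /= IHs; congr (_ *m _).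
  by rewrite rmorphB /= horner_mx_X horner_mx_C.
suff /(_ _) sx : forall i, complex_small (fun t => toC _ _ (x t) i 0).
  by move=> i; apply: exp_small_ext (sx i).1 _ => t; rewrite mxE.
apply: (annihilated_small (M := toC _ _ A) (h := fun t => toC _ _ (h t)) s0).
- move=> i; apply: (@complex_solves_eq _ _
    (fun t => real_complex R ((A *m x t + h t) i 0))) => [|t].
    split; first by apply: scalar_solves_ext (dx i 0) _ _ => t //; rewrite mxE.
    by apply: scalar_solves_ext (scalar_solves_cst 0) _ _ => t //; rewrite mxE.
  by rewrite -map_mxM -map_mxD [RHS]mxE.
- move=> i; split.
    by apply: exp_small_ext (sh i) _ => t; rewrite mxE.
  by apply: exp_small_ext (exp_small0 R) _ => t; rewrite mxE.
- move=> i; rewrite prod0.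
  by split; apply: exp_small_ext (exp_small0 R) _ => t; rewrite mul0mx mxE.
Qed.

(** * Laplacians of strongly connected digraphs *)

Lemma laplacian_mulmxE (R : realType) (N m : nat) (a : 'M[R]_N)
    (X : 'M[R]_(N, m)) i k : (forall i, a i i = 0) ->
  (laplacian a *m X) i k = \sum_j a i j * (X i k - X j k).
Proof.
move=> a0; rewrite mxE (bigD1 i)//= !mxE eqxx mulr_suml.
rewrite [LHS]addrC [X in _ + X](bigD1 i)//= a0 mul0r add0r -big_split/=.
rewrite [RHS](bigD1 i)//= a0 mul0r add0r.
apply: eq_bigr => j ji; rewrite mxE eq_sym (negbTE ji); by ring.
Qed.

(** If [r l = 0], the balance equation at [l] forces [r k = 0] at every [k] that
    receives information from [l]; positivity therefore propagates along edges
    backwards, and everywhere by strong connectivity. *)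
Lemma nonneg_left_null_pos (R : realType) (N : nat) (edge : rel 'I_N)
    (a : 'M[R]_N) (r : 'I_N -> R) :
  weighted_adjacency edge a -> strongly_connected edge ->
  (forall i, 0 <= r i) ->
  (forall j, r j * \sum_k a j k = \sum_i r i * a i j) ->
  forall i, 0 < r i -> forall j, 0 < r j.
Proof.
move=> [apos azero adiag] conn r0 rnull i ri j.
have age0 k l : 0 <= a k l.
  by case: (boolP (edge l k)) => [/apos/ltW|/azero ->].
have step k l : edge l k -> 0 < r k -> 0 < r l.
  move=> lk rk; rewrite lt_neqAle r0 andbT eq_sym; apply/negP => /eqP rl0.
  have := rnull l; rewrite rl0 mul0r => /esym/eqP.
  rewrite psumr_eq0; last by move=> m _; exact: mulr_ge0.
  move=> /allP /(_ k (mem_index_enum _)); rewrite mulf_eq0.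
  by rewrite (gt_eqF rk) (gt_eqF (apos _ _ lk)).
have /connectP[p] := conn j i.
elim: p j => [|k p IHp] j /=; first by move=> _ <-.
by move=> /andP[jk kp] ?; exact/(step _ _ jk)/IHp.
Qed.

(** A Perron-Frobenius argument.  The rows of the Laplacian sum to zero, so it
    has a left null vector [u].  The triangle inequality makes [|u|]
    subinvariant, and summing over the nodes forces equality at each of them,
    so [|u|] is a left null vector too. *)
Lemma laplacian_left_null (R : realType) (N : nat) (edge : rel 'I_N)
    (a : 'M[R]_N) : (0 < N)%N ->
  weighted_adjacency edge a -> strongly_connected edge ->
  exists r : 'I_N -> R, [/\ forall i, 0 < r i, \sum_i r i = 1 &
    forall j, r j * \sum_k a j k = \sum_i r i * a i j].
Proof.
move=> N0 adj conn; have [apos azero adiag] := adj.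
have age0 k l : 0 <= a k l.
  by case: (boolP (edge l k)) => [/apos/ltW|/azero ->].
have [u u0 uL] : exists2 u : 'rV[R]_N, u != 0 & u *m laplacian a = 0.
  have : ~~ row_free (laplacian a).
    rewrite row_free_unit unitmxE unitfE negbK -det_tr; apply/det0P.
    exists (const_mx 1); first by
      apply/rV0Pn; exists (Ordinal N0); rewrite mxE oner_eq0.
    apply: trmx_inj; rewrite trmx_mul trmxK trmx0; apply/matrixP => i k.
    rewrite laplacian_mulmxE// [RHS]mxE big1// => j _.
    by rewrite !mxE subrr mulr0.
  by rewrite -kermx_eq0 => /rowV0Pn[u /sub_kermxP uL u0]; exists u.
have unull j : u 0 j * \sum_k a j k = \sum_i u 0 i * a i j.
  have /matrixP/(_ 0 j) := uL; rewrite !mxE (bigD1 j)//= mxE eqxx => /eqP.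
  rewrite addr_eq0 => /eqP ->; rewrite [RHS](bigD1 j)//= adiag mulr0 add0r.
  rewrite -sumrN; apply: eq_bigr => i ij.
  by rewrite mxE (negbTE ij) mulrN opprK.
pose v i := `|u 0 i|.
have le_v j : v j * \sum_k a j k <= \sum_i v i * a i j.
  rewrite -[X in _ * X]ger0_norm ?sumr_ge0// -normrM unull.
  apply: le_trans (ler_norm_sum _ _ _) _; apply: ler_sum => i _.
  by rewrite normrM (ger0_norm (age0 _ _)).
have vnull j : v j * \sum_k a j k = \sum_i v i * a i j.
  pose d j := \sum_i v i * a i j - v j * \sum_k a j k.
  have d0 k : true -> 0 <= d k by rewrite subr_ge0.
  have : \sum_k d k = 0.
    rewrite sumrB exchange_big /= -sumrB big1// => k _.
    by rewrite -mulr_sumr subrr.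
  move=> /eqP; rewrite psumr_eq0// => /allP/(_ j (mem_index_enum _)).
  by rewrite /= subr_eq0 => /eqP.
have v0 i : 0 <= v i by exact: normr_ge0.
have [i ui] : exists i, u 0 i != 0 by exact/rV0Pn.
have vpos : forall j, 0 < v j.
  apply: (nonneg_left_null_pos adj conn v0 vnull (i := i)).
  by rewrite normr_gt0.
pose S := \sum_k v k.
have S0 : 0 < S.
  by rewrite /S (bigD1 (Ordinal N0))//= ltr_pwDl// sumr_ge0.
exists (fun j => v j / S); split.
- by move=> j; rewrite divr_gt0.
- by rewrite -mulr_suml divff// gt_eqF.
- move=> j; rewrite mulrAC vnull mulr_suml; apply: eq_bigr => k _.
  by rewrite mulrAC.
Qed.

(** [u i * (u i - u j)] is half of [(u i - u j)^2 + u i^2 - u j^2], and the last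
    two squares cancel in the sum because the weights [r i * a i j] are
    balanced. *)
Lemma dirichlet_form (R : realType) (N : nat) (a : 'M[R]_N) (r u : 'I_N -> R) :
  (forall j, r j * \sum_k a j k = \sum_i r i * a i j) ->
  \sum_i r i * (u i * \sum_j a i j * (u i - u j)) =
  2^-1 * \sum_i \sum_j r i * a i j * (u i - u j) ^+ 2.
Proof.
move=> rnull.
have balance : \sum_i \sum_j r i * a i j * u j ^+ 2 =
               \sum_i \sum_j r i * a i j * u i ^+ 2.
  rewrite exchange_big /=; apply: eq_bigr => i _.
  by rewrite -!mulr_suml -rnull -mulr_sumr.
have -> : \sum_i r i * (u i * \sum_j a i j * (u i - u j)) =
    2^-1 * \sum_i \sum_j r i * a i j * (u i - u j) ^+ 2 +
    2^-1 * (\sum_i \sum_j r i * a i j * u i ^+ 2 -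
            \sum_i \sum_j r i * a i j * u j ^+ 2).
  rewrite -mulrDr -sumrB -big_split mulr_sumr; apply: eq_bigr => i _ /=.
  rewrite -sumrB -big_split /= !mulr_sumr; apply: eq_bigr => j _; by field.
by rewrite balance subrr mulr0 addr0.
Qed.

(** The difference of two values telescopes along a path, each step of which is
    bounded by one term of the energy. *)
Lemma edge_energy_bound (R : realType) (N : nat) (edge : rel 'I_N)
    (a : 'M[R]_N) (r : 'I_N -> R) :
  weighted_adjacency edge a -> strongly_connected edge -> (forall i, 0 < r i) ->
  exists2 c : R, 0 < c & forall (i j : 'I_N) (u : 'I_N -> R),
    (u i - u j) ^+ 2 <= c * \sum_i \sum_j r i * a i j * (u i - u j) ^+ 2.
Proof.
move=> [apos azero adiag] conn rpos.
have age0 k l : 0 <= a k l.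
  by case: (boolP (edge l k)) => [/apos/ltW|/azero ->].
pose E (u : 'I_N -> R) := \sum_i \sum_j r i * a i j * (u i - u j) ^+ 2.
have term0 (u : 'I_N -> R) k l : 0 <= r k * a k l * (u k - u l) ^+ 2.
  by rewrite mulr_ge0 ?sqr_ge0// mulr_ge0// ltW.
have E0 u : 0 <= E u by apply: sumr_ge0 => k _; apply: sumr_ge0.
have pair (ij : 'I_N * 'I_N) : exists c : R, 0 <= c /\
    forall u, (u ij.1 - u ij.2) ^+ 2 <= c * E u.
  case: ij => i j /=; have /connectP[p] := conn i j.
  elim: p i => [|k p IHp] i /=.
    by move=> _ ->; exists 0; split => // u; rewrite subrr expr0n mul0r.
  move=> /andP[ik kp] jp; have [c [c0 cE]] := IHp k kp jp.
  have w0 : 0 < r k * a k i by rewrite mulr_gt0// apos.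
  exists (2 * (r k * a k i)^-1 + 2 * c); split.
    by rewrite addr_ge0// mulr_ge0// invr_ge0 ltW.
  move=> u; have := cE u => cEu.
  have eE : (r k * a k i)^-1 * E u >= (u k - u i) ^+ 2.
    rewrite ler_pdivlMl// /E (bigD1 k)//= (bigD1 i)//= -addrA lerDl.
    rewrite addr_ge0//; first by apply: sumr_ge0.
    by apply: sumr_ge0 => ? _; apply: sumr_ge0.
  have := sqr_ge0 ((u i - u k) - (u k - u j)).
  rewrite mulrDl -!mulrA.
  move: cEu eE; set A := c * E u; set B := _ * E u; nra.
have /choice[c cP] := pair.
have c0 : 0 <= \sum_ij c ij by apply: sumr_ge0 => ij _; exact: (cP ij).1.
exists (1 + \sum_ij c ij); first by rewrite ltr_pwDl.
move=> i j u; apply: le_trans ((cP (i, j)).2 u) _; rewrite -/(E u).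
rewrite ler_wpM2r// (bigD1 (i, j))//= addrCA lerDl addr_ge0//.
by apply: sumr_ge0 => ij _; exact: (cP ij).1.
Qed.

(** The variance of [u] for the probability weights [r] is half the average of
    [(u i - u j)^2] over all pairs, and each pair is bounded by the energy. *)
Lemma weighted_poincare (R : realType) (N : nat) (edge : rel 'I_N)
    (a : 'M[R]_N) (r : 'I_N -> R) :
  weighted_adjacency edge a -> strongly_connected edge ->
  (forall i, 0 < r i) -> \sum_i r i = 1 ->
  (forall j, r j * \sum_k a j k = \sum_i r i * a i j) ->
  exists2 c : R, 0 < c & forall u : 'I_N -> R,
    \sum_i r i * (u i - \sum_j r j * u j) ^+ 2 <=
    c * \sum_i r i * (u i * \sum_j a i j * (u i - u j)).
Proof.
move=> adj conn rpos rsum rnull.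
have [c c0 cE] := edge_energy_bound adj conn rpos.
exists c => // u; rewrite dirichlet_form//; set E := \sum_i \sum_j _.
set m := \sum_j r j * u j; pose s := \sum_j r j * u j ^+ 2.
have expand (x : R) : \sum_j r j * (x - u j) ^+ 2 = x ^+ 2 - 2 * x * m + s.
  rewrite -[x ^+ 2]mulr1 -[X in _ * X - _]rsum /m /s !mulr_sumr -sumrB.
  by rewrite -big_split /=; apply: eq_bigr => j _; ring.
have var : \sum_i r i * (u i - m) ^+ 2 = s - m ^+ 2.
  under eq_bigr do rewrite -sqrrN opprB.
  by rewrite expand; ring.
have : \sum_i r i * \sum_j r j * (u i - u j) ^+ 2 <= \sum_i r i * (c * E).
  apply: ler_sum => i _; rewrite ler_pM2l// -[leRHS]mul1r -rsum mulr_suml.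
  by apply: ler_sum => j _; rewrite ler_pM2l.
rewrite -mulr_suml rsum mul1r.
have -> : \sum_i r i * \sum_j r j * (u i - u j) ^+ 2 = 2 * (s - m ^+ 2).
  under eq_bigr do rewrite expand mulrDr mulrBr [_ * (_ * m)]mulrA.
  rewrite big_split sumrB -!mulr_suml rsum -/s /=.
  under [X in _ - X * _]eq_bigr do rewrite mulrCA.
  by rewrite -mulr_sumr -/m; ring.
rewrite var; lra.
Qed.

(** * Minimizing a sum of strongly convex functions *)

Lemma dotpE (R : realType) (q : nat) (u v : 'cV[R]_q) :
  dotp u v = \sum_k u k 0 * v k 0.
Proof. by rewrite /dotp mxE; apply: eq_bigr => k _; rewrite mxE. Qed.

Lemma enorm_sqr (R : realType) (q : nat) (v : 'cV[R]_q) :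
  enorm v ^+ 2 = \sum_k v k 0 ^+ 2.
Proof. by rewrite sqr_sqrtr// sumr_ge0// => k _; exact: sqr_ge0. Qed.

Lemma derive_gradient (R : realType) (q : nat) (f : 'cV[R]_q -> R)
    (x d : 'cV[R]_q) :
  differentiable f x -> 'D_d f x = dotp (gradient f x) d.
Proof.
move=> fx; rewrite deriveE// {1}(matrix_sum_delta d).
rewrite raddf_sum dotpE; apply: eq_bigr => k _ /=.
by rewrite big_ord1 linearZ /= mxE deriveE// mulrC.
Qed.

Lemma is_derive_line (R : realType) (q : nat) (f : 'cV[R]_q -> R)
    (x d : 'cV[R]_q) (t : R) : (forall y, differentiable f y) ->
  is_derive t 1 (fun s : R => f (s *: d + x))
    (dotp (gradient f (t *: d + x)) d).
Proof.
move=> df.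
have E : (fun h : R => h^-1 *: (f ((h *: 1 + t) *: d + x) - f (t *: d + x))) =
  (fun h : R => h^-1 *: (f (h *: d + (t *: d + x)) - f (t *: d + x))).
  by apply/funext => h; rewrite [h *: 1]mulr1 scalerDl addrA.
apply: DeriveDef.
  by rewrite /derivable /= E; exact: diff_derivable.
by rewrite /derive /= E -derive_gradient.
Qed.

(** The mean value theorem on the segment, applied to [f] minus the quadratic
    [m / 2 * |y - x|^2 * s^2], whose subtraction is what yields the quadratic
    term: the derivative of the difference is minimal at [s = 0]. *)
Lemma strongly_convex_quadratic (R : realType) (q : nat) (f : 'cV[R]_q -> R)
    (m : R) (x y : 'cV[R]_q) :
  (forall z, differentiable f z) -> strongly_convex f m ->
  f x + dotp (gradient f x) (y - x) + m / 2 * enorm (y - x) ^+ 2 <= f y.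
Proof.
move=> df fm; set d := y - x; set e := enorm d ^+ 2.
pose g (s : R) : R := f (s *: d + x) - m / 2 * e * s ^+ 2.
have dg (s : R) :
    is_derive s 1 g (dotp (gradient f (s *: d + x)) d - m * e * s).
  have df1 := is_derive_line x d s df.
  rewrite /g; apply: is_derive_eq.
  by rewrite /GRing.scale/=; congr (_ - _); field.
have [c c01] : exists2 c, c \in `]0, 1[%R & g 1 - g 0 =
    (dotp (gradient f (c *: d + x)) d - m * e * c) * (1 - 0).
  apply: MVT => //; apply: continuous_subspaceT => s.
  by apply: differentiable_continuous; apply/derivable1_diffP; have [] := dg s.
rewrite subr0 mulr1 /g scale1r scale0r add0r {1}/d subrK.
rewrite expr1n expr0n /= mulr1 mulr0 subr0 => gE.
have c0 : 0 < c by rewrite (itvP c01).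
have := fm (c *: d + x) x; rewrite addrK enorm_sqr.
have -> : \sum_k (c *: d) k 0 ^+ 2 = c ^+ 2 * e.
  by rewrite /e enorm_sqr mulr_sumr; apply: eq_bigr => k _; rewrite mxE exprMn.
have -> : dotp (c *: d) (gradient f (c *: d + x) - gradient f x) =
    c * (dotp (gradient f (c *: d + x)) d - dotp (gradient f x) d).
  rewrite !dotpE -sumrB mulr_sumr; apply: eq_bigr => k _.
  by rewrite !mxE; ring.
rewrite (_ : m * _ = c * (m * e * c)); last by ring.
by rewrite (ler_pM2l c0) => H; lra.
Qed.

Lemma trmx_continuous (R : realType) (m n : nat) :
  continuous (@trmx R m n).
Proof.
move=> M s /nbhs_ballP[e e0 es]; apply/nbhs_ballP; exists e => //= P [_ MP].
by apply: es; split => // i j; rewrite !mxE; exact: MP.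
Qed.

(** The quadratic lower bound at the origin keeps the sum above its value there
    outside a box, so a minimizer over the compact box is a global one. *)
Lemma strongly_convex_sum_minimizer (R : realType) (N q : nat)
    (f : 'I_N -> 'cV[R]_q -> R) (m : 'I_N -> R) :
  (0 < N)%N -> (forall i, 0 < m i) ->
  (forall i z, differentiable (f i) z) ->
  (forall i, strongly_convex (f i) (m i)) ->
  exists ystar : 'cV[R]_q,
    (forall k, \sum_i gradient (f i) ystar k 0 = 0) /\
    exists2 mu : R, 0 < mu & forall y,
      \sum_i f i ystar + mu * enorm (y - ystar) ^+ 2 <= \sum_i f i y.
Proof.
move=> N0 m0 df fm.
pose F (y : 'cV[R]_q) : R := \sum_i f i y.
pose G y : 'cV[R]_q := \sum_i gradient (f i) y.
have dotG y d : dotp (G y) d = \sum_i dotp (gradient (f i) y) d.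
  rewrite dotpE; under eq_bigr do rewrite summxE mulr_suml.
  by rewrite exchange_big; apply: eq_bigr => i _; rewrite dotpE.
have [mu mu0 Fquad] : exists2 mu : R, 0 < mu & forall x y : 'cV[R]_q,
    F x + dotp (G x) (y - x) + mu * enorm (y - x) ^+ 2 <= F y.
  exists (\sum_i m i / 2) => [|x y].
    rewrite (bigD1 (Ordinal N0))//= ltr_pwDl ?divr_gt0//.
    by apply: sumr_ge0 => i _; rewrite ltW// divr_gt0.
  rewrite dotG mulr_suml -!big_split; apply: ler_sum => i _.
  exact: strongly_convex_quadratic.
(* Completing the square in [G 0 . y + mu * |y|^2] shows that it is
   nonnegative as soon as [|y| >= |G 0| / mu]. *)
pose b : R := enorm (G 0).
pose rho : R := b / mu.
have b0 : 0 <= b by exact: sqrtr_ge0.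
have rho0 : 0 <= rho by rewrite divr_ge0// ltW.
have far (y : 'cV[R]_q) k : rho < `|y k 0| -> F 0 <= F y.
  move=> yk; apply: le_trans (Fquad 0 y); rewrite subr0 -addrA lerDl.
  have ey : rho ^+ 2 <= enorm y ^+ 2.
    rewrite enorm_sqr (bigD1 k)//=; apply: (@le_trans _ _ (y k 0 ^+ 2)).
      by rewrite -[leRHS]real_normK ?num_real// ler_pXn2r ?nnegrE// ltW.
    by rewrite lerDl; apply: sumr_ge0 => j _; exact: sqr_ge0.
  have : 0 <= \sum_k (G 0 k 0 + mu * y k 0) ^+ 2.
    by apply: sumr_ge0 => j _; exact: sqr_ge0.
  have -> : \sum_k (G 0 k 0 + mu * y k 0) ^+ 2 =
      \sum_k G 0 k 0 ^+ 2 + 2 * mu * (\sum_k G 0 k 0 * y k 0)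
      + mu ^+ 2 * \sum_k y k 0 ^+ 2.
    by rewrite !mulr_sumr -!big_split; apply: eq_bigr => j _ /=; ring.
  rewrite -!enorm_sqr -dotpE -/b => sq.
  have bE : b ^+ 2 = mu ^+ 2 * rho ^+ 2.
    by rewrite -exprMn /rho mulrC divfK// gt_eqF.
  have {ey} : b ^+ 2 <= mu ^+ 2 * enorm y ^+ 2.
    by rewrite bE ler_wpM2l// sqr_ge0.
  move: sq; set u := dotp _ _; set e := enorm y ^+ 2 => sq le_be.
  rewrite -(pmulr_rge0 _ mu0) mulrDr mulrA -expr2; lra.
have Fcont : continuous F.
  move=> z; have dF : differentiable F z.
    have -> : F = \sum_i f i by apply/funext => y; rewrite fct_sumE.
    exact: differentiable_sum.
  exact: differentiable_continuous dF.
pose box := [set v : 'rV[R]_q | forall i, v ord0 i \in `[- rho, rho]].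
have cbox : compact box.
  by apply: (@rV_compact _ _ (fun=> `[- rho, rho]%classic)) => _;
    exact: segment_compact.
have box0 : box 0 by move=> i; rewrite mxE in_itv/= oppr_le0 rho0.
have cF : {within box, continuous (fun v : 'rV[R]_q => F v^T)}.
  apply: continuous_subspaceT => v; apply: (continuous_comp _ (Fcont _)).
  exact: trmx_continuous.
have [v vbox vmin] := compact_EVT_min (ex_intro _ 0 box0) cbox cF.
pose ystar := v^T.
have gmin (y : 'cV[R]_q) : F ystar <= F y.
  have [/forallP yin|] := boolP [forall k, `|y k 0| <= rho].
    have := vmin y^T; rewrite trmxK; apply; rewrite inE => k.
    by rewrite mxE in_itv/= -ler_norml.
  rewrite negb_forall => /existsP[k]; rewrite -ltNge => /far; apply: le_trans.
  by have := vmin 0; rewrite trmx0; apply; rewrite inE.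
have G0 d : dotp (G ystar) d = 0.
  pose g (s : R) : R := F (s *: d + ystar).
  have dg (s : R) : is_derive s 1 g (dotp (G (s *: d + ystar)) d).
    rewrite dotG.
    have -> : g = \sum_i (fun s : R => f i (s *: d + ystar)).
      by apply/funext => y; rewrite fct_sumE.
    by apply: is_derive_sum => i; exact: is_derive_line.
  have g0 : is_derive (0 : R) (1 : R) g (0 : R).
    apply: (@derive1_at_min R g (- 1) 1) => [|t _||t _].
    - by rewrite (le_trans (lerN10 _) ler01).
    - by have [] := dg t.
    - by rewrite in_itv/= ltrN10 ltr01.
    - by rewrite /g scale0r add0r; exact: gmin.
  have := @derive_val _ _ _ _ _ _ _ g0.
  by rewrite (@derive_val _ _ _ _ _ _ _ (dg 0)) scale0r add0r.
exists ystar; split.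
  move=> k; have := G0 (delta_mx k 0); rewrite dotpE (bigD1 k)//= mxE !eqxx.
  rewrite big1 => [|j jk]; last by rewrite mxE (negbTE jk) mulr0.
  by rewrite addr0 mulr1 summxE.
exists mu => // y; apply: le_trans (Fquad ystar y).
by rewrite G0 addr0.
Qed.

(** * Consensus dynamics in the weighted inner product *)

(** The rows are the agents; the weight [r] is the left null vector of the
    Laplacian in all the uses below. *)
Definition wdot (R : realType) (N q : nat) (r : 'I_N -> R)
    (X Y : 'M[R]_(N, q)) : R :=
  \sum_i \sum_k r i * (X i k * Y i k).

Lemma wdotC (R : realType) (N q : nat) (r : 'I_N -> R) (X Y : 'M[R]_(N, q)) :
  wdot r X Y = wdot r Y X.
Proof. by do 2![apply: eq_bigr => ? _]; rewrite (mulrC (X _ _)). Qed.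

Lemma wdotDr (R : realType) (N q : nat) (r : 'I_N -> R)
    (X Y Z : 'M[R]_(N, q)) : wdot r X (Y + Z) = wdot r X Y + wdot r X Z.
Proof.
rewrite -big_split; apply: eq_bigr => i _ /=.
by rewrite -big_split; apply: eq_bigr => k _ /=; rewrite mxE !mulrDr.
Qed.

Lemma wdotZr (R : realType) (N q : nat) (r : 'I_N -> R) (c : R)
    (X Y : 'M[R]_(N, q)) : wdot r X (c *: Y) = c * wdot r X Y.
Proof.
rewrite mulr_sumr; apply: eq_bigr => i _.
by rewrite mulr_sumr; apply: eq_bigr => k _; rewrite mxE; ring.
Qed.

Lemma wdotNr (R : realType) (N q : nat) (r : 'I_N -> R)
    (X Y : 'M[R]_(N, q)) : wdot r X (- Y) = - wdot r X Y.
Proof. by rewrite -scaleN1r wdotZr mulN1r. Qed.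

Lemma wdotDl (R : realType) (N q : nat) (r : 'I_N -> R)
    (X Y Z : 'M[R]_(N, q)) : wdot r (X + Y) Z = wdot r X Z + wdot r Y Z.
Proof. by rewrite wdotC wdotDr !(wdotC r Z). Qed.

Lemma wdotZl (R : realType) (N q : nat) (r : 'I_N -> R) (c : R)
    (X Y : 'M[R]_(N, q)) : wdot r (c *: X) Y = c * wdot r X Y.
Proof. by rewrite wdotC wdotZr wdotC. Qed.

Lemma wdot_ge0 (R : realType) (N q : nat) (r : 'I_N -> R) (X : 'M[R]_(N, q)) :
  (forall i, 0 < r i) -> 0 <= wdot r X X.
Proof.
move=> r0; apply: sumr_ge0 => i _; apply: sumr_ge0 => k _.
by rewrite mulr_ge0 ?(ltW (r0 i))// -expr2 sqr_ge0.
Qed.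

Lemma wdot_entry (R : realType) (N q : nat) (r : 'I_N -> R)
    (X : 'M[R]_(N, q)) i :
  (forall i, 0 < r i) -> r i * \sum_k X i k ^+ 2 <= wdot r X X.
Proof.
move=> r0; rewrite /wdot (bigD1 i)//= mulr_sumr lerDl.
apply: sumr_ge0 => j _; apply: sumr_ge0 => k _.
by rewrite mulr_ge0 ?(ltW (r0 j))// -expr2 sqr_ge0.
Qed.

Lemma wdot_young (R : realType) (N q : nat) (r : 'I_N -> R) (c : R)
    (X Y : 'M[R]_(N, q)) : (forall i, 0 < r i) -> 0 < c ->
  wdot r X Y <= c * wdot r X X + (4 * c)^-1 * wdot r Y Y.
Proof.
move=> r0 c0; have := wdot_ge0 (c *: X + (- 2^-1) *: Y) r0.
rewrite wdotDl !wdotDr !wdotZl !wdotZr (wdotC r Y X) => H.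
rewrite -(ler_pM2l c0) mulrDr invfM -subr_ge0.
move: H; congr (is_true (0 <= _)).
by field; rewrite gt_eqF.
Qed.

Lemma wdot_solves (R : realType) (N q : nat) (r : 'I_N -> R)
    (X Y W Z : R -> 'M[R]_(N, q)) : mx_solves X W -> mx_solves Y Z ->
  scalar_solves (fun t => wdot r (X t) (Y t))
    (fun t => wdot r (W t) (Y t) + wdot r (X t) (Z t)).
Proof.
move=> XW YZ; apply: scalar_solves_ext (scalar_solves_sum _ (fun i =>
  scalar_solves_sum _ (fun k => scalar_solvesZ (r i)
    (scalar_solvesM (XW i k) (YZ i k))))) _ _ => t //.
rewrite -big_split; apply: eq_bigr => i _ /=.
by rewrite -big_split; apply: eq_bigr => k _ /=; rewrite mulrDr.
Qed.

Definition center (R : realType) (N q : nat) (r : 'I_N -> R)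
    (X : 'M[R]_(N, q)) : 'M[R]_(N, q) :=
  \matrix_(i, k) (X i k - \sum_j r j * X j k).

Lemma center_id (R : realType) (N q : nat) (r : 'I_N -> R)
    (X : 'M[R]_(N, q)) : (forall k, \sum_j r j * X j k = 0) -> center r X = X.
Proof. by move=> X0; apply/matrixP => i k; rewrite mxE X0 subr0. Qed.

(** The rows of [center r X - X] are all equal, hence orthogonal to a matrix
    whose weighted column means vanish. *)
Lemma wdot_centerl (R : realType) (N q : nat) (r : 'I_N -> R)
    (X W : 'M[R]_(N, q)) : (forall k, \sum_j r j * W j k = 0) ->
  wdot r (center r X) W = wdot r X W.
Proof.
move=> W0; apply/eqP; rewrite -subr_eq0; apply/eqP.
rewrite -sumrB; under eq_bigr do rewrite -sumrB.
rewrite exchange_big big1// => k _ /=.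
rewrite -[RHS](mulr0 (- \sum_j r j * X j k)).
rewrite -[X in _ * X](W0 k) mulr_sumr; apply: eq_bigr => i _; rewrite mxE.
by ring.
Qed.

Lemma weighted_poincare_mx (R : realType) (N q : nat) (edge : rel 'I_N)
    (a : 'M[R]_N) (r : 'I_N -> R) :
  weighted_adjacency edge a -> strongly_connected edge ->
  (forall i, 0 < r i) -> \sum_i r i = 1 ->
  (forall j, r j * \sum_k a j k = \sum_i r i * a i j) ->
  exists2 c : R, 0 < c & forall X : 'M[R]_(N, q),
    wdot r (center r X) (center r X) <= c * wdot r X (laplacian a *m X).
Proof.
move=> adj conn rpos rsum rnull; have [_ _ adiag] := adj.
have [c c0 cP] := weighted_poincare adj conn rpos rsum rnull.
have colE (X Y : 'M[R]_(N, q)) :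
    wdot r X Y = \sum_k \sum_i r i * (X i k * Y i k) by exact: exchange_big.
exists c => // X; rewrite !colE mulr_sumr; apply: ler_sum => k _.
under eq_bigr do rewrite !mxE -expr2.
by under [in leRHS]eq_bigr do rewrite laplacian_mulmxE//.
Qed.

(** The conservation law [r L = 0]; it holds from the initial time on, which is
    where the initial values of [v] and [z] enter. *)
Lemma weighted_mean_const (R : realType) (N q : nat) (a : 'M[R]_N)
    (r : 'I_N -> R) (b : R) (Y Z : R -> 'M[R]_(N, q)) :
  (forall i, a i i = 0) ->
  (forall j, r j * \sum_k a j k = \sum_i r i * a i j) ->
  mx_solves Y (fun t => b *: (laplacian a *m Z t)) ->
  forall k t, 0 <= t -> \sum_i r i * Y t i k = \sum_i r i * Y 0 i k.
Proof.
move=> adiag rnull dY k.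
pose rv : 'rV[R]_N := \row_i r i.
have rvL : rv *m laplacian a = 0.
  apply/matrixP => i j; rewrite !mxE (bigD1 j)//= !mxE eqxx rnull.
  rewrite (bigD1 j)//= adiag mulr0 add0r -big_split big1// => l lj /=.
  by rewrite !mxE (negbTE lj) mulrN subrr.
have rvY t : \sum_i r i * Y t i k = (rv *m Y t) 0 k.
  by rewrite mxE; apply: eq_bigr => i _; rewrite mxE.
move=> t t0; rewrite !rvY.
apply: (@scalar_solves_const R (fun t => (rv *m Y t) 0 k)) t0.
apply: scalar_solves_eq (mx_solvesM rv dY 0 k) _ => s _.
by rewrite -scalemxAr mulmxA rvL mul0mx scaler0 mxE.
Qed.

Lemma laplacian_const_rows (R : realType) (N q : nat) (a : 'M[R]_N)
    (y : 'I_q -> R) : (forall i, a i i = 0) ->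
  laplacian a *m (\matrix_(i < N, k < q) y k) = 0.
Proof.
move=> adiag; apply/matrixP => i k; rewrite laplacian_mulmxE// [RHS]mxE.
by rewrite big1// => j _; rewrite !mxE subrr mulr0.
Qed.

(** The weighted mean of column [k] of [Z] keeps its initial value [r k], so [Z]
    minus its limit is centered and the Poincare inequality makes its squared
    norm decrease exponentially. *)
Lemma left_null_estimator_cvg (R : realType) (N : nat) (edge : rel 'I_N)
    (a : 'M[R]_N) (r : 'I_N -> R) (Z : R -> 'M[R]_N) :
  weighted_adjacency edge a -> strongly_connected edge ->
  (forall i, 0 < r i) -> \sum_i r i = 1 ->
  (forall j, r j * \sum_k a j k = \sum_i r i * a i j) ->
  mx_solves Z (fun t => - (laplacian a *m Z t)) -> Z 0 = 1%:M ->
  forall i k, exp_small (fun t => Z t i k - r k).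
Proof.
move=> adj conn rpos rsum rnull dZ Z0; have [_ _ adiag] := adj.
have [c c0 cP] := weighted_poincare_mx N adj conn rpos rsum rnull.
pose C : 'M[R]_N := \matrix_(i, k) r k.
pose D t := Z t - C.
have LD t : laplacian a *m Z t = laplacian a *m D t.
  by rewrite mulmxBr laplacian_const_rows// subr0.
have dD : mx_solves D (fun t => - (laplacian a *m D t)).
  apply: mx_solves_eq (mx_solvesB dZ (mx_solves_cst C)) _ => t _.
  by rewrite LD subr0.
have dV := wdot_solves r dD dD.
have meanD t : 0 <= t -> forall k, \sum_i r i * D t i k = 0.
  move=> t0 k; under eq_bigr do rewrite !mxE mulrBr.
  rewrite sumrB -mulr_suml rsum mul1r.
  rewrite (@weighted_mean_const _ _ _ a r (- 1) Z Z)//; last first.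
    by apply: mx_solves_eq dZ _ => s _; rewrite scaleN1r.
  rewrite Z0 (bigD1 k)//= mxE eqxx mulr1 big1 ?addr0 ?subrr// => i ik.
  by rewrite mxE (negbTE ik) mulr0.
have sV : exp_small (fun t => wdot r (D t) (D t)).
  have ci0 : 0 < 2 * c^-1 by rewrite mulr_gt0// invr_gt0.
  apply: (exp_small_lyapunov (T0 := 0) dV _ ci0 (exp_small0 R)) => [t|t t0 _].
    exact: wdot_ge0.
  have := cP (D t); rewrite center_id; last exact/meanD/ltW.
  rewrite addr0 wdotNr (wdotC r (- _)) wdotNr mulNr -mulrA -ler_pdivrMl//.
  lra.
move=> i k; apply: exp_small_sqr.
apply: (exp_small_le (T0 := 0) _ (exp_smallZ (r i)^-1 sV)) => t _ _.
rewrite !ger0_norm ?sqr_ge0//; last first.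
  by rewrite mulr_ge0 ?wdot_ge0// invr_ge0 ltW.
rewrite ler_pdivlMl//; apply: le_trans (wdot_entry _ i rpos).
rewrite ler_pM2l// (bigD1 k)//= !mxE lerDl.
by apply: sumr_ge0 => j _; exact: sqr_ge0.
Qed.

(** Half the derivative of [wdot r (Y + W) (Y + W) + k * wdot r Y Y] is
    [- (1 + k) <Y,g> - <W,g> - (1 + k) <Y,W> - <W,W> - k gamma1 <Y,L Y>] plus
    the terms in [p].  Young's inequality leaves three quarters of [<W,W>]
    spent on [<W,g>], [<Y,W>] and [<W,p>]; [k] is chosen such that
    [k * mu = Gam + mu], so that [<Y,g>] covers the resulting [Gam * <Y,Y>], and
    [gamma1] such that [k * gamma1 * <Y,L Y>] covers
    [(1 + k)^2 * <center Y,center Y>]. *)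
Lemma consensus_optimization_lyapunov (R : realType) (N q : nat) (a : 'M[R]_N)
    (r : 'I_N -> R) (c mu Gam : R) (Y W g p : R -> 'M[R]_(N, q)) (E : R -> R) :
  (forall i, 0 < r i) -> 0 < c -> 0 < mu -> 0 <= Gam ->
  (forall X : 'M[R]_(N, q), wdot r (center r X) (center r X) <=
     c * wdot r X (laplacian a *m X)) ->
  let k := Gam / mu + 1 in
  let gamma1 := (1 + k) ^+ 2 * c / k in
  mx_solves Y (fun t =>
    - g t - gamma1 *: (laplacian a *m Y t) - W t + p t) ->
  mx_solves W (fun t => gamma1 *: (laplacian a *m Y t)) ->
  (forall t, 0 < t -> forall k, \sum_i r i * W t i k = 0) ->
  (forall t, mu * wdot r (Y t) (Y t) <= wdot r (Y t) (g t)) ->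
  (forall t, wdot r (g t) (g t) <= Gam * wdot r (Y t) (Y t)) ->
  (forall t, wdot r (p t) (p t) <= E t * (1 + wdot r (Y t) (Y t))) ->
  exp_small E ->
  exp_small (fun t => wdot r (Y t) (Y t)).
Proof.
move=> r0 c0 mu0 Gam0 cP k gamma1 dY dW W0 Yg gg pE sE.
have k0 : 0 < k by rewrite /k ltr_wpDl// divr_ge0// ltW.
have kmu : k * mu = Gam + mu by rewrite /k mulrDl divfK ?mul1r// gt_eqF.
have kgam : k * gamma1 = (1 + k) ^+ 2 * c.
  by rewrite /gamma1 mulrC divfK// gt_eqF.
have dS := mx_solvesD dY dW.
have dV := scalar_solvesD (wdot_solves r dS dS)
  (scalar_solvesZ k (wdot_solves r dY dY)).
pose V t := wdot r (Y t + W t) (Y t + W t) + k * wdot r (Y t) (Y t).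
pose c1 : R := (1 + k) ^+ 2 / mu + 1.
have c10 : 0 < c1 by rewrite ltr_wpDl// divr_ge0 ?sqr_ge0// ltW.
have k2 : 0 < 2 + k by rewrite addr_gt0.
(* Without the term in [E], the derivative of [V] is at most
   [- mu <Y,Y> - <W,W> / 2], while [V] itself is at most
   [(2 + k) <Y,Y> + 2 <W,W>]. *)
pose al : R := Num.min (mu / (2 + k)) 4^-1.
have al0 : 0 < al by rewrite lt_min divr_gt0 ?invr_gt0 ?ltr0n.
have alk : al * (2 + k) <= mu.
  by rewrite -(ler_pdivlMr _ _ k2) /al ge_min lexx.
have al4 : al <= 4^-1 by rewrite /al ge_min lexx orbT.
have sE1 := exp_smallZ (2 * c1) sE.
have [T T0 ET] := exp_small_eventually sE1 mu0.
have sV : exp_small V.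
  apply: (exp_small_lyapunov (T0 := T) dV _ al0 sE1) => [t|t t0 Tt].
    by rewrite addr_ge0 ?mulr_ge0 ?wdot_ge0// ltW.
  have {ET} Et := le_trans (ler_norm _) (ET t Tt).
  move: (Yg t) (gg t) (pE t) (W0 t t0) (cP (Y t)) => {}Yg {}gg {}pE {}W0 {}cP.
  have YW : - (1 + k) * wdot r (Y t) (W t) <=
      4^-1 * wdot r (W t) (W t)
      + k * gamma1 * wdot r (Y t) (laplacian a *m Y t).
    have := wdot_young (W t) (- (1 + k) *: center r (Y t)) r0
      (c := 4^-1) ltac:(by []).
    rewrite wdotC !wdotZl wdotZr wdot_centerl//.
    move=> /le_trans; apply; rewrite lerD2l kgam.
    rewrite divff// invr1 mul1r mulrA -expr2 sqrrN -mulrA ler_wpM2l ?sqr_ge0//.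
  have Wg := wdot_young (W t) (- g t) r0 (c := 4^-1) ltac:(by []).
  have Wp := wdot_young (W t) (p t) r0 (c := 4^-1) ltac:(by []).
  have Yp := wdot_young (Y t) ((1 + k) *: p t) r0 (c := mu / 4)
    ltac:(by rewrite divr_gt0).
  move: YW Wg Wp Yp Yg gg pE Et.
  rewrite !(wdotDl, wdotDr, wdotNr, wdotZl, wdotZr).
  rewrite !(wdotC r (- _)) !(wdotDl, wdotDr, wdotNr, wdotZl, wdotZr).
  rewrite !(wdotC r _ (Y t)) (wdotC r (p t) (W t)).
  rewrite (wdotC r (laplacian a *m Y t) (W t)) opprK.
  have YY0 := wdot_ge0 (Y t) r0; have WW0 := wdot_ge0 (W t) r0.
  have YW2 := wdot_young (Y t) (W t) r0 (c := 2^-1) ltac:(by []).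
  move: YY0 WW0 YW2.
  set YY := wdot r (Y t) (Y t); set WW := wdot r (W t) (W t).
  set YW := wdot r (Y t) (W t); set YL := wdot r (Y t) (laplacian a *m Y t).
  set WL := wdot r (W t) (laplacian a *m Y t).
  set Yg := wdot r (Y t) (g t); set Wg := wdot r (W t) (g t).
  set gg := wdot r (g t) (g t); set pp := wdot r (p t) (p t).
  set Yp := wdot r (Y t) (p t); set Wp := wdot r (W t) (p t).
  move=> YY0 WW0 YW2 hYW hWg hWp hYp hYg hgg hpp hE.
  have hYp' : (1 + k) * Yp <= mu / 4 * YY + (1 + k) ^+ 2 / mu * pp.
    apply: le_trans hYp _; rewrite lerD2l le_eqVlt; apply/orP; left; apply/eqP.
    by field; rewrite gt_eqF.
  have hc1 : c1 * pp <= c1 * E t + mu / 2 * YY.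
    apply: (@le_trans _ _ (c1 * (E t * (1 + YY)))).
      by rewrite ler_wpM2l// ltW.
    rewrite mulrA mulrDr mulr1 lerD2l ler_wpM2r//; lra.
  have hYg' : (Gam + 2 * mu) * YY <= (1 + k) * Yg.
    have -> : Gam + 2 * mu = (1 + k) * mu by rewrite [RHS]mulrDl kmu; ring.
    by rewrite -mulrA ler_wpM2l// addr_ge0// ltW.
  have hal : al * (YY + 2 * YW + WW + k * YY) <= mu * YY + 2^-1 * WW.
    apply: (@le_trans _ _ (al * (2 + k) * YY + al * 2 * WW)).
      rewrite -!mulrA -mulrDr ler_wpM2l ?(ltW al0)//; lra.
    by apply: lerD; rewrite ler_wpM2r//; lra.
  have hc1' : c1 * pp = (1 + k) ^+ 2 / mu * pp + pp by rewrite /c1; ring.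
  rewrite hc1' in hc1.
  have muYY : 0 <= mu * YY by rewrite mulr_ge0// ltW.
  rewrite -subr_ge0; set rhs := (X in 0 <= X).
  have -> : rhs = - (al * (YY + 2 * YW + WW + k * YY)) + 2 * (c1 * E t)
      + 2 * ((1 + k) * Yg + Wg + (1 + k) * YW + WW - (1 + k) * Yp - Wp
             + k * gamma1 * YL).
    by rewrite /rhs; ring.
  move: hYW hWg hWp.
  clearbody YY WW YW YL WL Yg Wg gg pp Yp Wp gamma1 al k c1.
  clear -hYp' hc1 hYg' hal muYY hgg YW2 WW0.
  move: hYp' hc1 hYg' hal; set e1 := (1 + k) ^+ 2 / mu * pp.
  rewrite [- (1 + k) * YW]mulNr.
  set e2 := k * gamma1 * YL; set e3 := (1 + k) * Yg; set e4 := (1 + k) * Yp.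
  set e5 := (1 + k) * YW.
  lra.
apply: (exp_small_le (T0 := 0) _ (exp_smallZ k^-1 sV)) => t _ _.
rewrite !ger0_norm ?wdot_ge0//; last first.
  by rewrite mulr_ge0 ?addr_ge0 ?mulr_ge0 ?wdot_ge0 ?invr_ge0// ltW.
by rewrite ler_pdivlMl// lerDr wdot_ge0.
Qed.

(** * The closed loop *)

(** Separation of estimation, tracking and planning: [x - xhat] decays by itself,
    it forces [x - Psi rho], and the output differs from [rho] by a linear
    image of the latter.  The derivative [eta] of that difference decays
    too. *)
Lemma tracking_output (R : realType) (n p q : nat) (A : 'M[R]_n)
    (B : 'M[R]_(n, p)) (C : 'M[R]_(q, n)) (K : 'M[R]_(p, n))
    (H : 'M[R]_(n, q)) (Ups Phi : 'M[R]_(p, q)) (Psi : 'M[R]_(n, q))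
    (x xhat : R -> 'cV[R]_n) (u : R -> 'cV[R]_p) (rho omega : R -> 'cV[R]_q) :
  hurwitz (A - B *m K) -> hurwitz (A - H *m C) ->
  C *m Psi - 1%:M = 0 -> B *m Phi - A *m Psi = 0 -> B *m Ups - Psi = 0 ->
  mx_solves x (fun t => A *m x t + B *m u t) ->
  mx_solves xhat (fun t => A *m xhat t + B *m u t
                           + H *m (C *m x t - C *m xhat t)) ->
  mx_solves rho omega ->
  (forall t : R, 0 < t -> u t = - (K *m xhat t) + Ups *m omega t
                          - (Phi - K *m Psi) *m rho t) ->
  exists2 eta : R -> 'cV[R]_q,
    mx_solves (fun t => C *m x t) (fun t => omega t + eta t) &
    forall k, exp_small (fun t => eta t k 0).
Proof.
move=> hK hH /subr0_eq CPsi /subr0_eq BPhi /subr0_eq BUps dx dxhat drho uE.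
pose e t := x t - xhat t.
pose xi t := x t - Psi *m rho t.
have de : mx_solves e (fun t => (A - H *m C) *m e t + 0).
  apply: mx_solves_eq (mx_solvesB dx dxhat) _ => t _.
  rewrite addr0 -mulmxBr -/(e t) mulmxA mulmxBl [in RHS]mulmxBr.
  by rewrite opprD addrA (addrC (A *m xhat t)) addrKA mulmxBr.
have se : forall i, exp_small (fun t => e t i 0).
  apply: (hurwitz_small hH de) => i.
  by apply: exp_small_ext (exp_small0 R) _ => t; rewrite mxE.
have smul (m l : nat) (P : 'M[R]_(m, l)) (g : R -> 'cV[R]_l) :
    (forall i, exp_small (fun t => g t i 0)) ->
    forall i, exp_small (fun t => (P *m g t) i 0).
  move=> sg i; apply: exp_small_ext (exp_small_sum _ (fun k =>
    exp_smallZ (P i k) (sg k))) _ => t; exact: mxE.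
have xdot (t : R) : 0 < t -> A *m x t + B *m u t =
    Psi *m omega t + ((A - B *m K) *m xi t + B *m K *m e t).
  move=> t0; rewrite uE// /xi /e.
  rewrite !(mulmxDr, mulmxBl, mulmxN, mulmxA) BPhi BUps.
  move: (A *m x t) (B *m K *m xhat t) (Psi *m omega t) (A *m Psi *m rho t).
  move: (B *m K *m Psi *m rho t) (B *m K *m x t) => v1 v2 v3 v4 v5 v6.
  by apply/matrixP => i j; rewrite !mxE; ring.
have dxi : mx_solves xi (fun t => (A - B *m K) *m xi t + B *m K *m e t).
  apply: mx_solves_eq (mx_solvesB dx (mx_solvesM Psi drho)) _ => t t0.
  by rewrite xdot// [Psi *m _ + _]addrC addrK.
have sxi := hurwitz_small hK dxi (smul _ _ _ _ se).
exists (fun t => C *m ((A - B *m K) *m xi t + B *m K *m e t)).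
  apply: mx_solves_eq (mx_solvesM C dx) _ => t t0.
  by rewrite xdot// mulmxDr mulmxA CPsi mul1mx.
apply: (smul) => i; apply: exp_small_ext (exp_smallD
  (smul _ _ (A - B *m K) _ sxi i) (smul _ _ (B *m K) _ se i)) _ => t.
exact: mxE.
Qed.

Lemma pos_lower_bound (R : realType) (N : nat) (d : 'I_N -> R) :
  (forall i, 0 < d i) -> exists2 mu : R, 0 < mu & forall i, mu <= d i.
Proof.
move=> d0; have S0 : 0 <= \sum_i (d i)^-1.
  by apply: sumr_ge0 => i _; rewrite invr_ge0 ltW.
exists (1 + \sum_i (d i)^-1)^-1; first by rewrite invr_gt0 ltr_pwDl.
move=> i; rewrite -[leRHS]invrK lef_pV2 ?posrE ?invr_gt0 ?ltr_pwDl//.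
rewrite (bigD1 i)//= addrCA lerDl addr_ge0//.
by apply: sumr_ge0 => j _; rewrite invr_ge0 ltW.
Qed.

Lemma laplacian_tensE (R : realType) (N q : nat) (a : 'M[R]_N)
    (Y : 'cV[R]_(N * q)) (i : 'I_N) (k : 'I_q) :
  ((laplacian a *t (1%:M : 'M[R]_q)) *m Y) (mxtens_index (i, k)) 0 =
  (laplacian a *m \matrix_(j, l) block Y j l 0) i k.
Proof.
rewrite mxE [RHS]mxE (reindex (@mxtens_index N q)); last first.
  by exists (@mxtens_unindex N q) => l _;
    rewrite ?mxtens_indexK ?mxtens_unindexK.
transitivity (\sum_j \sum_l (laplacian a *t (1%:M : 'M[R]_q))
    (mxtens_index (i, k)) (mxtens_index (j, l)) * Y (mxtens_index (j, l)) 0).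
  by rewrite pair_bigA; apply: eq_bigr => -[].
apply: eq_bigr => j _.
rewrite (bigD1 k)//= tensmxE [X in _ * X * _]mxE eqxx mulr1.
rewrite big1 ?addr0 => [|l lk]; first by do 2!rewrite [X in _ = _ * X]mxE.
by rewrite tensmxE [X in _ * X * _]mxE eq_sym (negbTE lk) mulr0 mul0r.
Qed.

(** A feasible [Y] has zero energy, so all its blocks are equal by
    strong connectivity and its cost is that of its common block. *)
Lemma consensus_minimizer (R : realType) (N q : nat)
    (f : 'I_N -> 'cV[R]_q -> R) (edge : rel 'I_N) (a : 'M[R]_N)
    (ystar : 'cV[R]_q) (mu : R) :
  (0 < N)%N -> weighted_adjacency edge a -> strongly_connected edge ->
  0 < mu ->
  (forall y, \sum_i f i ystar + mu * enorm (y - ystar) ^+ 2 <= \sum_i f i y) ->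
  is_the_minimizer setT (fun y : 'cV[R]_q => \sum_(i < N) f i y) ystar /\
  is_the_minimizer
    [set Y : 'cV[R]_(N * q) | (laplacian a *t (1%:M : 'M[R]_q)) *m Y = 0]
    (fun Y : 'cV[R]_(N * q) => \sum_(i < N) f i (block Y i))
    ((const_mx 1 : 'cV[R]_N) *t ystar).
Proof.
move=> N0 adj conn mu0 growth; have [_ _ adiag] := adj.
have min y : \sum_i f i ystar <= \sum_i f i y.
  by apply: le_trans (growth y); rewrite lerDl mulr_ge0 ?sqr_ge0// ltW.
have uniq_min y : \sum_i f i y <= \sum_i f i ystar -> y = ystar.
  move=> yle; have := le_trans (growth y) yle.
  rewrite gerDl pmulr_rle0// => e0.
  have /eqP : enorm (y - ystar) ^+ 2 = 0 by apply/eqP; rewrite eq_le e0 sqr_ge0.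
  rewrite enorm_sqr psumr_eq0 => [/allP y0|k _]; last exact: sqr_ge0.
  apply/matrixP => k j; have := y0 k (mem_index_enum _).
  by rewrite (ord1 j) /= sqrf_eq0 !mxE subr_eq0 => /eqP.
split.
  split; first by split => // y _; exact: min.
  by move=> y [_ ymin]; apply: uniq_min; exact: ymin.
set Yb := _ *t ystar; pose i0 := Ordinal N0.
have blockYb i : block Yb i = ystar.
  apply/matrixP => k j; rewrite mxE /Yb mxE mxtens_indexK mxE mul1r.
  by congr (ystar k _); rewrite !ord1.
have feasible Y : (laplacian a *t (1%:M : 'M[R]_q)) *m Y = 0 ->
    forall i, block Y i = block Y i0.
  move=> LY i; have [r [rpos _ rnull]] := laplacian_left_null N0 adj conn.
  have [c c0 cE] := edge_energy_bound adj conn rpos.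
  apply/matrixP => k j; rewrite (ord1 j).
  have := cE i i0 (fun l => block Y l k 0).
  have := dirichlet_form (fun l => block Y l k 0) rnull.
  rewrite big1 => [/esym/eqP|l _].
    rewrite mulf_eq0 invr_eq0 pnatr_eq0 /= => /eqP ->; rewrite mulr0 => le0.
    apply/eqP; rewrite -subr_eq0 -sqrf_eq0; apply/eqP/le_anti.
    by rewrite le0 sqr_ge0.
  have := laplacian_tensE a Y l k; rewrite LY [LHS]mxE laplacian_mulmxE//.
  under eq_bigr do rewrite 2![in X in _ * X]mxE.
  by move=> <-; rewrite !mulr0.
have feasYb : (laplacian a *t (1%:M : 'M[R]_q)) *m Yb = 0.
  apply/matrixP => l j; case: (mxtens_indexP l) => i k.
  rewrite (ord1 j) laplacian_tensE [RHS]mxE laplacian_mulmxE// big1// => s _.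
  by rewrite [X in _ * (X - _)]mxE [X in _ * (_ - X)]mxE !blockYb subrr mulr0.
have costYb : \sum_i f i (block Yb i) = \sum_i f i ystar.
  by apply: eq_bigr => i _; rewrite blockYb.
have costY Y : (forall i, block Y i = block Y i0) ->
    \sum_i f i (block Y i) = \sum_i f i (block Y i0).
  by move=> Yi; apply: eq_bigr => i _; rewrite Yi.
split.
  split=> // Y /feasible/costY ->; rewrite costYb; exact: min.
move=> Y [/feasible Yi /(_ _ feasYb)]; rewrite costYb (costY _ Yi).
move=> /uniq_min Y0.
apply/matrixP => l j; case: (mxtens_indexP l) => i k; rewrite (ord1 j).
have /matrixP/(_ k 0) : block Y i = block Yb i by rewrite Yi Y0 blockYb.
by rewrite !mxE.
Qed.

(** The deviations from the equilibrium satisfy the hypotheses of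
    [consensus_optimization_lyapunov] with
    [g = (grad f (y) - grad f (ystar)) / r] and, as perturbation, [eta] plus
    the error made in replacing [1 / r i] by [1 / z i i].  That error multiplies
    [grad f (y)], which grows at most linearly in the deviation: this is why
    the perturbation is bounded by [E * (1 + <Y,Y>)]. *)
Lemma network_convergence (R : realType) (N q : nat)
    (f : 'I_N -> 'cV[R]_q -> R) (m M : 'I_N -> R)
    (edge : rel 'I_N) (a : 'M[R]_N) (ystar : 'cV[R]_q) :
  (0 < N)%N -> (forall i, 0 < m i) -> (forall i, strongly_convex (f i) (m i)) ->
  (forall i, globally_lipschitz (gradient (f i)) (M i)) ->
  weighted_adjacency edge a -> strongly_connected edge ->
  (forall k, \sum_i gradient (f i) ystar k 0 = 0) ->
  exists2 gamma1 : R, 0 < gamma1 &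
  forall (y omega eta v : 'I_N -> R -> 'cV[R]_q) (z : 'I_N -> R -> 'cV[R]_N),
  (forall i, mx_solves (y i) (fun t => omega i t + eta i t)) ->
  (forall i k, exp_small (fun t => eta i t k 0)) ->
  (forall i (t : R), 0 < t ->
    omega i t = - ((z i t i 0)^-1 *: gradient (f i) (y i t))
                - gamma1 *: (\sum_(j < N) a i j *: (y i t - y j t))
                - v i t) ->
  (forall i, mx_solves (v i) (fun t =>
    gamma1 *: (\sum_(j < N) a i j *: (y i t - y j t)))) ->
  (forall i, mx_solves (z i) (fun t =>
    - \sum_(j < N) a i j *: (z i t - z j t))) ->
  (forall i, v i 0 = 0) ->
  (forall i j, z i 0 j 0 = (j == i)%:R) ->
  forall i k, exp_small (fun t => y i t k 0 - ystar k 0).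
Proof.
move=> N0 m0 fm fM adj conn gstar; have [_ _ adiag] := adj.
have [r [rpos rsum rnull]] := laplacian_left_null N0 adj conn.
have [c c0 cP] := weighted_poincare_mx q adj conn rpos rsum rnull.
have [mu mu0 mule] : exists2 mu : R, 0 < mu & forall i, mu <= m i / r i.
  by apply: pos_lower_bound => i; rewrite divr_gt0.
pose Gam : R := \sum_i M i ^+ 2 / r i ^+ 2.
have Gam0 : 0 <= Gam by apply: sumr_ge0 => i _; rewrite divr_ge0// sqr_ge0.
pose kk : R := Gam / mu + 1.
have kk0 : 0 < kk by rewrite ltr_wpDl// divr_ge0// ltW.
pose gamma1 : R := (1 + kk) ^+ 2 * c / kk.
exists gamma1.
  by rewrite divr_gt0// mulr_gt0// exprn_gt0// addr_gt0.
move=> y omega eta v z dy seta omegaE dv dz v0 z0.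
pose G i := gradient (f i).
pose S : 'M[R]_(N, q) := \matrix_(i, k) ystar k 0.
pose Y t : 'M[R]_(N, q) := (\matrix_(i, k) y i t k 0) - S.
(* [v] must balance the gradients at the optimum: [- Vs = grad f (ystar) / r]. *)
pose Vs : 'M[R]_(N, q) := \matrix_(i, k) (- (r i)^-1 * G i ystar k 0).
pose W t : 'M[R]_(N, q) := (\matrix_(i, k) v i t k 0) - Vs.
pose g t : 'M[R]_(N, q) :=
  \matrix_(i, k) ((r i)^-1 * (G i (y i t) k 0 - G i ystar k 0)).
pose ep i t : R := (r i)^-1 - (z i t i 0)^-1.
pose P t : 'M[R]_(N, q) :=
  \matrix_(i, k) (eta i t k 0 + ep i t * G i (y i t) k 0).
have YE i (t : R) k : Y t i k = y i t k 0 - ystar k 0 by rewrite !mxE.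
have sz : forall i, exp_small (fun t => z i t i 0 - r i).
  pose Z t : 'M[R]_N := \matrix_(i, k) z i t k 0.
  have dZ : mx_solves Z (fun t => - (laplacian a *m Z t)).
    move=> i k; apply: scalar_solves_ext (dz i k 0) _ _ => t.
      by rewrite mxE.
    rewrite mxE laplacian_mulmxE// [RHS]mxE summxE; congr (- _).
    by apply: eq_bigr => j _; rewrite !mxE.
  have Z0 : Z 0 = 1%:M by apply/matrixP => i k; rewrite !mxE z0 eq_sym.
  move=> i; apply: exp_small_ext
    (left_null_estimator_cvg adj conn rpos rsum rnull dZ Z0 i i) _ => t.
  by rewrite mxE.
have sep (i : 'I_N) : exp_small (ep i).
  have ri2 : 0 < r i / 2 by rewrite divr_gt0.
  have [T T0 zT] := exp_small_eventually (sz i) ri2.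
  have sz2 := exp_smallZ (2 / r i ^+ 2) (sz i).
  apply: (exp_small_le (T0 := T) _ sz2) => t _ Tt.
  have := zT t Tt; rewrite ler_distl => /andP[zlo _].
  have zpos : r i / 2 <= z i t i 0 by lra.
  have z_gt0 : 0 < z i t i 0 by exact: lt_le_trans zpos.
  have -> : ep i t = (r i * z i t i 0)^-1 * (z i t i 0 - r i).
    by rewrite /ep; field; rewrite !gt_eqF.
  rewrite normrM [leRHS]normrM ler_wpM2r//.
  have rz0 : 0 < r i * z i t i 0 by rewrite mulr_gt0.
  have r20 : 0 < 2 / r i ^+ 2 by rewrite divr_gt0// exprn_gt0.
  rewrite ger0_norm ?invr_ge0 ?(ltW rz0)// ger0_norm ?(ltW r20)//.
  rewrite -[leLHS]mul1r ler_pdivrMr//.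
  have -> : 2 / r i ^+ 2 * (r i * z i t i 0) = 2 * z i t i 0 / r i.
    by field; rewrite gt_eqF.
  by rewrite ler_pdivlMr//; lra.
pose b i : R := \sum_k G i ystar k 0 ^+ 2.
have Gdiff : forall (i : 'I_N) (t : R),
    \sum_k (G i (y i t) k 0 - G i ystar k 0) ^+ 2 <=
    M i ^+ 2 * \sum_k Y t i k ^+ 2.
  move=> i t.
  have M0 : 0 <= M i * enorm (y i t - ystar).
    by apply: le_trans (fM i (y i t) ystar); exact: sqrtr_ge0.
  have := fM i (y i t) ystar.
  rewrite -(@ler_pXn2r _ 2) ?nnegrE ?sqrtr_ge0// exprMn !enorm_sqr.
  congr (_ <= _ * _); apply: eq_bigr => k _; first by rewrite !mxE.
  by rewrite YE !mxE.
pose E t : R := \sum_i (2 * r i * (\sum_k eta i t k 0 ^+ 2)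
  + (4 * r i * b i + 4 * M i ^+ 2) * ep i t ^+ 2).
have sE : exp_small E.
  apply: exp_small_sum => i; apply: exp_smallD.
    apply: exp_smallZ; apply: exp_small_sum => k.
    by apply: exp_small_ext (exp_smallM (seta i k) (seta i k)) _ => t.
  apply: exp_smallZ.
  by apply: exp_small_ext (exp_smallM (sep i) (sep i)) _ => t.
have pE (t : R) : wdot r (P t) (P t) <= E t * (1 + wdot r (Y t) (Y t)).
  set YY := wdot r (Y t) (Y t); have YY0 : 0 <= YY by exact: wdot_ge0.
  rewrite /E mulr_suml; apply: ler_sum => i _.
  rewrite -mulr_sumr.
  have Gsq : \sum_k G i (y i t) k 0 ^+ 2 <= 2 * b i +
      2 * \sum_k (G i (y i t) k 0 - G i ystar k 0) ^+ 2.
    rewrite !mulr_sumr -big_split; apply: ler_sum => k _ /=.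
    have := sqr_ge0 (2 * G i ystar k 0 - G i (y i t) k 0); lra.
  have Psq : \sum_k P t i k * P t i k <= 2 * \sum_k eta i t k 0 ^+ 2
      + 2 * ep i t ^+ 2 * \sum_k G i (y i t) k 0 ^+ 2.
    rewrite !mulr_sumr -big_split; apply: ler_sum => k _ /=.
    rewrite mxE; have := sqr_ge0 (eta i t k 0 - ep i t * G i (y i t) k 0); lra.
  have rY : r i * \sum_k Y t i k ^+ 2 <= YY by exact: wdot_entry.
  have := Gdiff i t; move: Gsq Psq rY.
  have eta0 : 0 <= \sum_k eta i t k 0 ^+ 2.
    by apply: sumr_ge0 => k _; exact: sqr_ge0.
  have b0 : 0 <= b i by apply: sumr_ge0 => k _; exact: sqr_ge0.
  set s1 := \sum_k G i (y i t) k 0 ^+ 2; set s2 := \sum_k Y t i k ^+ 2.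
  set s3 := \sum_k (_ - _) ^+ 2; set s4 := \sum_k P t i k * _.
  move: eta0; set s5 := \sum_k _ ^+ 2; set e2 := ep i t ^+ 2.
  have e20 : 0 <= e2 by exact: sqr_ge0.
  move=> s50 h1 h2 h3 h4.
  have M20 : 0 <= M i ^+ 2 by exact: sqr_ge0.
  have hr : r i * s4 <= r i * (2 * s5) + 2 * e2 * (r i * s1).
    have := ler_wpM2l (ltW (rpos i)) h2; rewrite mulrDr; lra.
  have hs1 : r i * s1 <= 2 * (r i * b i) + 2 * (M i ^+ 2 * YY).
    have : r i * s1 <= r i * (2 * b i + 2 * (M i ^+ 2 * s2)).
      by rewrite ler_pM2l//; lra.
    have := ler_wpM2l M20 h3; lra.
  have he : e2 * (r i * s1) <= e2 * (2 * (r i * b i) + 2 * (M i ^+ 2 * YY)).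
    exact: ler_wpM2l.
  have rb0 : 0 <= 2 * r i * s5 + 4 * (r i * b i * e2).
    have rs0 := mulr_ge0 (ltW (rpos i)) s50.
    have rbe0 := mulr_ge0 (mulr_ge0 (ltW (rpos i)) b0) e20.
    lra.
  have Me0 : 0 <= M i ^+ 2 * e2 by exact: mulr_ge0.
  have := mulr_ge0 rb0 YY0; lra.
have LY (t : R) i k : (laplacian a *m Y t) i k =
    (\sum_j a i j *: (y i t - y j t)) k 0.
  rewrite laplacian_mulmxE// summxE; apply: eq_bigr => j _.
  by rewrite !YE !mxE; ring.
have dY : mx_solves Y (fun t =>
    - g t - gamma1 *: (laplacian a *m Y t) - W t + P t).
  move=> i k.
  have dyi := scalar_solvesD (dy i k 0) (scalar_solves_cst (- ystar k 0)).
  apply: scalar_solves_eq (scalar_solves_ext dyi (YE i ^~ k) (fun=> erefl)) _.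
  move=> t t0; rewrite addr0 mxE omegaE// -/(G i).
  have -> : (- g t - gamma1 *: (laplacian a *m Y t) - W t + P t) i k =
      - g t i k - gamma1 * (laplacian a *m Y t) i k - W t i k + P t i k.
    by move: (laplacian a *m Y t) (g t) (W t) (P t) => ? ? ? ?; rewrite !mxE.
  rewrite LY; move: (\sum_j a i j *: (y i t - y j t)) => s.
  have -> : W t i k = v i t k 0 + (r i)^-1 * G i ystar k 0.
    by rewrite !mxE mulNr opprK.
  by rewrite !mxE /ep; ring.
have dW : mx_solves W (fun t => gamma1 *: (laplacian a *m Y t)).
  move=> i k; apply: scalar_solves_ext
    (scalar_solvesD (dv i k 0) (scalar_solves_cst (- Vs i k))) _ _ => t.
    by rewrite !mxE.
  by rewrite addr0 [LHS]mxE LY [RHS]mxE.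
have W0 (t : R) : 0 < t -> forall k, \sum_i r i * W t i k = 0.
  move=> t0 k; rewrite (@weighted_mean_const _ _ _ a r gamma1 W Y)// ?ltW//.
  transitivity (\sum_i G i ystar k 0); last exact: gstar.
  apply: eq_bigr => i _.
  have -> : W 0 i k = v i 0 k 0 - - (r i)^-1 * G i ystar k 0.
    by rewrite !mxE.
  rewrite v0 mxE.
  by field; rewrite gt_eqF.
have Yg (t : R) : mu * wdot r (Y t) (Y t) <= wdot r (Y t) (g t).
  rewrite mulr_sumr; apply: ler_sum => i _; rewrite -!mulr_sumr mulrA.
  have -> : r i * \sum_k Y t i k * g t i k =
      dotp (y i t - ystar) (G i (y i t) - G i ystar).
    rewrite dotpE mulr_sumr; apply: eq_bigr => k _.
    by rewrite YE !mxE; field; rewrite gt_eqF.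
  apply: le_trans (fm i _ _); rewrite enorm_sqr.
  rewrite (eq_bigr (fun k => (y i t - ystar) k 0 ^+ 2)) => [|k _]; last first.
    by rewrite YE !mxE.
  rewrite ler_wpM2r//; first by apply: sumr_ge0 => k _; exact: sqr_ge0.
  by rewrite -ler_pdivlMr.
have gg (t : R) : wdot r (g t) (g t) <= Gam * wdot r (Y t) (Y t).
  rewrite mulr_sumr; apply: ler_sum => i _; rewrite -!mulr_sumr.
  have -> : r i * \sum_k g t i k * g t i k =
      (r i)^-1 * \sum_k (G i (y i t) k 0 - G i ystar k 0) ^+ 2.
    rewrite !mulr_sumr; apply: eq_bigr => k _.
    by rewrite !mxE; field; rewrite gt_eqF.
  have ri0 : 0 <= (r i)^-1 by rewrite invr_ge0 ltW.
  apply: le_trans (ler_wpM2l ri0 (Gdiff i t)) _.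
  under [in leRHS]eq_bigr do rewrite -expr2.
  set s2 := \sum_k _.
  have -> : (r i)^-1 * (M i ^+ 2 * s2) = M i ^+ 2 / r i ^+ 2 * (r i * s2).
    by field; rewrite gt_eqF.
  rewrite ler_wpM2r//.
    by rewrite mulr_ge0 ?(ltW (rpos i))// sumr_ge0// => k _; exact: sqr_ge0.
  rewrite /Gam (bigD1 i)//= lerDl.
  by apply: sumr_ge0 => j _; rewrite divr_ge0// sqr_ge0.
have sY := consensus_optimization_lyapunov rpos c0 mu0 Gam0 cP dY dW W0 Yg gg
  pE sE.
move=> i k; apply: exp_small_sqr.
apply: (exp_small_le (T0 := 0) _ (exp_smallZ (r i)^-1 sY)) => t _ _.
rewrite !ger0_norm ?sqr_ge0//; last first.
  by rewrite mulr_ge0 ?wdot_ge0// invr_ge0 ltW.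
rewrite ler_pdivlMl//; apply: le_trans (wdot_entry _ i rpos).
rewrite ler_pM2l// (bigD1 k)//= !YE lerDl.
by apply: sumr_ge0 => j _; exact: sqr_ge0.
Qed.

Unset Implicit Arguments.

Theorem theorem2 (R : realType) (N q : nat) (n p : 'I_N -> nat)
    (N_gt0 : (0 < N)%N)
    (A : forall i : 'I_N, 'M[R]_(n i))
    (B : forall i : 'I_N, 'M[R]_(n i, p i))
    (C : forall i : 'I_N, 'M[R]_(q, n i))
    (f : 'I_N -> 'cV[R]_q -> R) (m M : 'I_N -> R)
    (edge : rel 'I_N) (a : 'M[R]_N)
    (K : forall i : 'I_N, 'M[R]_(p i, n i))
    (H : forall i : 'I_N, 'M[R]_(n i, q))
    (Ups Phi : forall i : 'I_N, 'M[R]_(p i, q))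
    (Psi : forall i : 'I_N, 'M[R]_(n i, q))
    (f_C1 : forall i, C1 (f i))
    (m_gt0 : forall i, 0 < m i)
    (f_convex : forall i, strongly_convex (f i) (m i))
    (M_gt0 : forall i, 0 < M i)
    (f_lipschitz : forall i, globally_lipschitz (gradient (f i)) (M i))
    (a_adj : weighted_adjacency edge a)
    (a_connected : strongly_connected edge)
    (AB_stab : forall i, stabilizable (A i) (B i))
    (AB_rank : forall i,
      \rank (block_mx (C i *m B i) (0 : 'M[R]_(q, p i))
                      (- (A i *m B i)) (B i)) = (n i + q)%N)
    (AC_detect : forall i, detectable (A i) (C i))
    (K_hurwitz : forall i, hurwitz (A i - B i *m K i))
    (H_hurwitz : forall i, hurwitz (A i - H i *m C i))
    (eq_Psi : forall i, C i *m Psi i - 1%:M = 0)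
    (eq_Phi : forall i, B i *m Phi i - A i *m Psi i = 0)
    (eq_Ups : forall i, B i *m Ups i - Psi i = 0) :
  exists ystar : 'cV[R]_q,
  let Ybar : 'cV[R]_(N * q) := (const_mx 1 : 'cV[R]_N) *t ystar in
  [/\ is_the_minimizer setT (fun y : 'cV[R]_q => \sum_(i < N) f i y) ystar,
      is_the_minimizer
        [set Y : 'cV[R]_(N * q) |
          (laplacian a *t (1%:M : 'M[R]_q)) *m Y = 0]
        (fun Y : 'cV[R]_(N * q) => \sum_(i < N) f i (block Y i)) Ybar
    & exists gamma1 gamma2 : R, [/\ 0 < gamma1, 0 < gamma2 &
      forall (x xhat : forall i : 'I_N, R -> 'cV[R]_(n i))
             (u : forall i : 'I_N, R -> 'cV[R]_(p i))
             (y rho omega v : 'I_N -> R -> 'cV[R]_q)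
             (z : 'I_N -> R -> 'cV[R]_N),
        (* plant *)
        (forall i, solves (x i) (fun t => A i *m x i t + B i *m u i t)) ->
        (forall i (t : R), 0 <= t -> y i t = C i *m x i t) ->
        (* controller *)
        (forall i (t : R), 0 <= t ->
          u i t = - (K i *m xhat i t) + Ups i *m omega i t
                  - (Phi i - K i *m Psi i) *m rho i t) ->
        (forall i, solves (xhat i) (fun t =>
          A i *m xhat i t + B i *m u i t
          + H i *m (y i t - C i *m xhat i t))) ->
        (forall i, solves (rho i) (omega i)) ->
        (forall i (t : R), 0 <= t ->
          omega i t = - ((z i t i 0)^-1 *: gradient (f i) (y i t))
                      - gamma1 *: (\sum_(j < N) a i j *: (y i t - y j t))
                      - gamma2 *: v i t) ->
        (forall i, solves (v i) (fun t =>
          gamma1 *: (\sum_(j < N) a i j *: (y i t - y j t)))) ->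
        (forall i, solves (z i) (fun t =>
          - \sum_(j < N) a i j *: (z i t - z j t))) ->
        (* initial values *)
        (forall i, v i 0 = 0) ->
        (forall i j, z i 0 j 0 = (j == i)%:R) ->
        exists c alpha : R, [/\ 0 <= c, 0 < alpha &
          forall t : R, 0 <= t ->
            enorm (stack (fun i => y i t) - Ybar)
              <= c * expR (- alpha * t)]]].
Proof.
have [ystar [gstar [mu mu0 growth]]] := strongly_convex_sum_minimizer N_gt0
  m_gt0 (fun i => (f_C1 i).1) f_convex.
have [min_y min_Y] :=
  consensus_minimizer N_gt0 a_adj a_connected mu0 growth.
exists ystar; split => //.
have [gamma1 gamma1_gt0 cvg] := network_convergence N_gt0 m_gt0 f_convex
  f_lipschitz a_adj a_connected gstar.
exists gamma1, 1; split => // x xhat u y rho omega v z dx yE uE dxhat drho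
  omegaE dv dz v0 z0.
pose y' i t := C i *m x i t.
have yy' i t : 0 < t -> y i t = y' i t by move=> /ltW/yE.
have dy' i : exists2 eta : R -> 'cV[R]_q,
    mx_solves (y' i) (fun t => omega i t + eta t) &
    forall k, exp_small (fun t => eta t k 0).
  apply: (tracking_output (K_hurwitz i) (H_hurwitz i) (eq_Psi i) (eq_Phi i)
    (eq_Ups i) (solves_coord (dx i)) _ (solves_coord (drho i))) => [|t t0].
    by apply: mx_solves_eq (solves_coord (dxhat i)) _ => t t0; rewrite yy'.
  exact/uE/ltW.
have [eta etaP] : exists eta : 'I_N -> R -> 'cV[R]_q, forall i,
    mx_solves (y' i) (fun t => omega i t + eta i t) /\
    forall k, exp_small (fun t => eta i t k 0).
  have /choice[eta etaP] : forall i, exists eta : R -> 'cV[R]_q,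
      mx_solves (y' i) (fun t => omega i t + eta t) /\
      forall k, exp_small (fun t => eta t k 0).
    by move=> i; have [e ? ?] := dy' i; exists e.
  by exists eta.
have sumE i t : 0 < t -> \sum_(j < N) a i j *: (y i t - y j t) =
    \sum_(j < N) a i j *: (y' i t - y' j t).
  by move=> t0; apply: eq_bigr => j _; rewrite !yy'.
have sy' := cvg y' omega eta v z (fun i => (etaP i).1) (fun i => (etaP i).2).
have {}sy' : forall i k, exp_small (fun t => y' i t k 0 - ystar k 0).
  apply: sy' => //.
  - by move=> i t t0; rewrite omegaE ?ltW// sumE// yy'// scale1r.
  - move=> i; apply: mx_solves_eq (solves_coord (dv i)) _ => t t0.
    by rewrite sumE.
  - by move=> i; exact: solves_coord.
(* The vector dev lists the deviations in the order of the stacked output, so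
   that no reindexing of the norm is needed. *)
pose dev (l : 'I_(N * q)) t : R :=
  y' (mxtens_unindex l).1 t (mxtens_unindex l).2 0
  - ystar (mxtens_unindex l).2 0.
pose S t : R := \sum_l dev l t * dev l t.
have sS : exp_small S.
  by apply: exp_small_sum => l; apply: exp_smallM; exact: sy'.
have cS : {within `[0, +oo[, continuous S}.
  have dS := scalar_solves_sum (index_enum _) (fun l : 'I_(N * q) =>
    let ddev := scalar_solvesD ((etaP (mxtens_unindex l).1).1
      (mxtens_unindex l).2 0)
      (scalar_solves_cst (- ystar (mxtens_unindex l).2 0))
    in scalar_solvesM ddev ddev).
  exact: dS.1.
have [c [alpha [c0 alpha0 Sle]]] := exp_small_global cS sS.
exists (Num.sqrt c), (alpha / 2); split; rewrite ?sqrtr_ge0 ?divr_gt0//.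
move=> t t0.
have ES : enorm (stack (fun i => y i t) - (const_mx 1 : 'cV[R]_N) *t ystar) =
    Num.sqrt (S t).
  congr Num.sqrt; apply: eq_bigr => l _; rewrite -expr2 /dev /y' -yE//.
  congr (_ ^+ 2); rewrite mxE [X in X + _]mxE [X in _ + X]mxE [X in - X]mxE.
  by rewrite mxE mul1r; congr (_ - ystar _ _); rewrite ord1.
have S0 : 0 <= S t by apply: sumr_ge0 => l _; rewrite -expr2 sqr_ge0.
rewrite ES -(@ler_pXn2r _ 2) ?nnegrE ?mulr_ge0 ?sqrtr_ge0 ?expR_ge0//.
rewrite sqr_sqrtr// exprMn sqr_sqrtr// -expRM_natl.
rewrite (_ : 2 * (- (alpha / 2) * t) = - alpha * t); last by field.
by apply: le_trans (Sle t t0); exact: ler_norm.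
Qed.
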